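(* Let $(M,\varphi_i,\xi_i,\eta_i,g)$, $i=1,2,3$, be a canonical almost $3$-contact metric manifold of dimension $4n+3$, $n\ge1$, with canonical connection $\nabla$ (torsion $T$). Assume that its Reeb Killing function $\beta$ is constant and negative. If $\nabla'$ is the metric connection on $M$ with skew torsion $$T'=T+\beta(\eta_1\wedge\Phi_1+\eta_2\wedge\Phi_2+\eta_3\wedge\Phi_3),$$ then the appendant connection $\bar\nabla'$ on the cone $(\bar M,\bar g)=(M\times\mathbb R^+,a^2r^2g+dr^2)$ with cone constant $a=-\frac\beta2$ is a hermitian connection, i.e. it parallelizes the almost hermitian structures $J_1,J_2,J_3$ on $(\bar M,\bar g)$: $\bar\nabla'J_1=\bar\nabla'J_2=\bar\nabla'J_3=0$. If, furthermore, $(M,\varphi_i,\xi_i,\eta_i,g)$ is a $3$-$(\alpha,\delta)$-Sasaki manifold, then the cone $(\bar M,\bar g)$ (with $J_1,J_2,J_3$) is an HKT manifold.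
   Context: An almost contact metric structure $(\varphi,\xi,\eta,g)$ consists of a $(1,1)$-tensor field $\varphi$, a vector field $\xi$, a $1$-form $\eta$ and a Riemannian metric $g$ with $\varphi^2=-I+\eta\otimes\xi$, $\eta(\xi)=1$, $g(\varphi X,\varphi Y)=g(X,Y)-\eta(X)\eta(Y)$. Its fundamental form is $\Phi(X,Y)=g(X,\varphi Y)$, and $N_\varphi(X,Y)=[\varphi X,\varphi Y]+\varphi^2[X,Y]-\varphi[\varphi X,Y]-\varphi[X,\varphi Y]+d\eta(X,Y)\xi$, $N_\varphi(X,Y,Z)=g(N_\varphi(X,Y),Z)$. An almost $3$-contact metric manifold $(M,\varphi_i,\xi_i,\eta_i,g)$, $i=1,2,3$, is a manifold of dimension $4n+3$ with three almost contact metric structures with the same $g$ such that, for every even permutation $(i,j,k)$ of $(1,2,3)$, $\varphi_k=\varphi_i\varphi_j-\eta_j\otimes\xi_i=-\varphi_j\varphi_i+\eta_i\otimes\xi_j$, $\xi_k=\varphi_i\xi_j=-\varphi_j\xi_i$, $\eta_k=\eta_i\circ\varphi_j=-\eta_j\circ\varphi_i$. Set $\mathcal H=\bigcap_i\ker\eta_i$. It is $3$-$(\alpha,\delta)$-Sasaki if $d\eta_i=2\alpha\Phi_i+2(\alpha-\delta)\eta_j\wedge\eta_k$ for every even permutation $(i,j,k)$, with real constants $\alpha\neq0$, $\delta$ (such a manifold is canonical with $\beta=2(\delta-2\alpha)$). For $X,Y\in\Gamma(\mathcal H)$ let $A_{ij}(X,Y)=g((\mathcal L_{\xi_j}\varphi_i)X,Y)+d\eta_j(X,\varphi_iY)+d\eta_j(\varphi_iX,Y)$,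 $A_i=A_{ii}$. $M$ admits a Reeb Killing function $\beta\in C^\infty(M)$ if $A_i(X,Y)=0$ and $A_{ij}(X,Y)=-A_{ji}(X,Y)=\beta\Phi_k(X,Y)$ for all $X,Y\in\Gamma(\mathcal H)$ and every even permutation $(i,j,k)$ of $(1,2,3)$. $M$ is canonical if: 1) each $N_{\varphi_i}$ is skew-symmetric on $\mathcal H$ (i.e. $N_{\varphi_i}(X,Y,Z)$ restricted to $\mathcal H$ is a $3$-form); 2) each $\xi_i$ is Killing; 3) $N_{\varphi_i}(X,Y,Z)-d\Phi_i(\varphi_iX,\varphi_iY,\varphi_iZ)=N_{\varphi_j}(X,Y,Z)-d\Phi_j(\varphi_jX,\varphi_jY,\varphi_jZ)$ for all $X,Y,Z\in\Gamma(\mathcal H)$ and all $i,j$; 4) $M$ admits a Reeb Killing function $\beta$. A metric connection has skew torsion if $T(X,Y,Z)=g(T(X,Y),Z)$ is a $3$-form; it equals $\nabla^g+\frac12T$, $\nabla^g$ the Levi-Civita connection. The canonical connection of a canonical manifold is the unique metric connection $\nabla$ with skew torsion such that $\nabla_X\varphi_i=\beta(\eta_k(X)\varphi_j-\eta_j(X)\varphi_k)$ for all $X$ and every even permutation $(i,j,k)$ of $(1,2,3)$. Appendant connection: for a metric connection on $(M,g)$ with skew torsion $T$ and $a>0$ (the cone constant), the appendant connection on $(\bar M,\bar g)=(M\times\mathbb R^+,a^2r^2g+dr^2)$ is $\bar\nabla=\nabla^{\bar g}+\frac12\bar T$, where $\bar T(X,Y)=T(X,Y)$ (as vector-valued $2$-form)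 for $X,Y\perp\partial_r$ and $\partial_r\lrcorner\bar T=0$. Almost hermitian structures on $(\bar M,\bar g)$: for $i=1,2$: $J_i(ar\partial_r)=\xi_i$, $J_i(\xi_i)=-ar\partial_r$, $J_i(V)=-\varphi_i(V)$ for $V\perp\xi_i,\partial_r$; and $J_3(ar\partial_r)=-\xi_3$, $J_3(\xi_3)=ar\partial_r$, $J_3(V)=\varphi_3(V)$ for $V\perp\xi_3,\partial_r$. They satisfy $J_1J_2=J_3=-J_2J_1$. An HKT manifold (hyper-Kähler with torsion) is a hyperhermitian manifold (integrable complex structures $J_1,J_2,J_3$ with $J_1J_2=J_3=-J_2J_1$, compatible with the metric) admitting a metric connection $\nabla^c$ with skew torsion such that $\nabla^cJ_i=0$, $i=1,2,3$. Conventions: $d\eta(X,Y)=X(\eta(Y))-Y(\eta(X))-\eta([X,Y])$, $(\eta\wedge\Phi)(X,Y,Z)=\eta(X)\Phi(Y,Z)+\eta(Y)\Phi(Z,X)+\eta(Z)\Phi(X,Y)$, and analogously (no numerical factors) in general. *)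

(* Defs.v *)
From HB Require Import structures.
From mathcomp Require Import all_boot all_order all_algebra.
From mathcomp Require Import all_classical all_reals all_analysis.

Set Implicit Arguments.
Unset Strict Implicit.
Unset Printing Implicit Defensive.

Import Order.TTheory GRing.Theory Num.Theory.
Import numFieldNormedType.Exports.

Local Open Scope classical_set_scope.
Local Open Scope ring_scope.

Section Smooth.
Context {R : realType} {V W : normedModType R}.

(* Only used on finite-dimensional V and open U, where "differentiable with all
   directional derivatives of class C^k" is the usual C^(k+1). *)
Fixpoint Ck_on (k : nat) (U : set V) (f : V -> W) : Prop :=
  match k with
  | 0 => forall x, U x -> {for x, continuous f}
  | k'.+1 => (forall x, U x -> differentiable f x) /\
             (forall v, Ck_on k' U (fun x => 'D_v f x))
  end.

Definition smooth_on (U : set V) (f : V -> W) := forall k, Ck_on k U f.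

End Smooth.

(* Smooth m-manifolds: a Hausdorff second countable space with a smooth atlas.
   The chart c is the homeomorphism [crd c] from the open set [cdom c] of M onto
   the open set [cimg c] of R^m, with inverse [par c]; both maps are totalized
   and only meaningful on these sets. *)
Record manifold (R : realType) (m : nat) := Manifold {
  mspace :> topologicalType;
  mhausdorff : hausdorff_space mspace;
  msecond_countable : @second_countable mspace;
  chart : Type;
  cdom : chart -> set mspace;
  cimg : chart -> set 'rV[R]_m;
  crd : chart -> mspace -> 'rV[R]_m;
  par : chart -> 'rV[R]_m -> mspace;
  cdom_open : forall c, open (cdom c);
  cimg_open : forall c, open (cimg c);
  crd_cimg : forall c p, cdom c p -> cimg c (crd c p);
  par_cdom : forall c x, cimg c x -> cdom c (par c x);
  crdK : forall c p, cdom c p -> par c (crd c p) = p;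
  parK : forall c x, cimg c x -> crd c (par c x) = x;
  crd_continuous : forall c p, cdom c p -> {for p, continuous (crd c)};
  par_continuous : forall c x, cimg c x -> {for x, continuous (par c)};
  atlas_cover : forall p, exists c, cdom c p;
  transition_smooth : forall c d,
    smooth_on (cimg c `&` par c @^-1` cdom d) (crd d \o par c)
}.

Arguments cimg {R m} M c : rename.
Arguments cdom {R m} M c : rename.
Arguments crd {R m} M c p : rename.
Arguments par {R m} M c x : rename.

(* A tensor field on M is the family of its components in the charts of the
   atlas: at a point x of [cimg M c], a multilinear map on the tangent space
   R^m. Its values outside [cimg M c] are junk. The predicates [is_*] express
   multilinearity, smoothness and the transformation law under changes of
   chart. *)
Section Tensors.
Context {R : realType} {m : nat} (M : manifold R m).
Local Notation E := 'rV[R]_m.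

Definition overlap (c d : chart M) : set E :=
  cimg M c `&` par M c @^-1` cdom M d.
Definition transition (c d : chart M) : E -> E := crd M d \o par M c.
Definition push (c d : chart M) (x v : E) : E := 'D_v (transition c d) x.

Definition smooth_function (f : M -> R) :=
  forall c, smooth_on (cimg M c) (f \o par M c).

Definition vfield := chart M -> E -> E.
Definition oneform := chart M -> E -> E -> R.
Definition tensor02 := chart M -> E -> E -> E -> R.
Definition tensor11 := chart M -> E -> E -> E.
Definition tensor12 := chart M -> E -> E -> E -> E.

Definition is_vfield (X : vfield) :=
  (forall c, smooth_on (cimg M c) (X c)) /\
  (forall c d x, overlap c d x ->
     X d (transition c d x) = push c d x (X c x)).

Definition is_oneform (w : oneform) :=
  [/\ forall c x, cimg M c x -> scalar (w c x),
      forall c v, smooth_on (cimg M c) (fun x => w c x v)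
    & forall c d x v, overlap c d x ->
        w d (transition c d x) (push c d x v) = w c x v].

Definition is_tensor02 (h : tensor02) :=
  [/\ forall c x u, cimg M c x -> scalar (h c x u) /\ scalar (h c x ^~ u),
      forall c u v, smooth_on (cimg M c) (fun x => h c x u v)
    & forall c d x u v, overlap c d x ->
        h d (transition c d x) (push c d x u) (push c d x v) = h c x u v].

Definition is_tensor11 (f : tensor11) :=
  [/\ forall c x, cimg M c x -> linear (f c x),
      forall c v, smooth_on (cimg M c) (fun x => f c x v)
    & forall c d x v, overlap c d x ->
        f d (transition c d x) (push c d x v) = push c d x (f c x v)].

Definition is_tensor12 (T : tensor12) :=
  [/\ forall c x u, cimg M c x -> linear (T c x u) /\ linear (T c x ^~ u),
      forall c u v, smooth_on (cimg M c) (fun x => T c x u v)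
    & forall c d x u v, overlap c d x ->
        T d (transition c d x) (push c d x u) (push c d x v) =
        push c d x (T c x u v)].

Definition is_metric (g : tensor02) :=
  [/\ is_tensor02 g,
      forall c x u v, cimg M c x -> g c x u v = g c x v u
    & forall c x u, cimg M c x -> u != 0 -> 0 < g c x u u].

(* A vector field X defined on the domain of the chart c. Identities "for all
   vector fields" are local and are stated for such fields in every chart. *)
Definition local_vf (c : chart M) (X : E -> E) := smooth_on (cimg M c) X.

Definition lie (X Y : E -> E) : E -> E :=
  fun x => 'D_(X x) Y x - 'D_(Y x) X x.

Definition app11 (f : tensor11) c (X : E -> E) : E -> E := fun x => f c x (X x).

Definition lieD11 (Z : vfield) (f : tensor11) c (X : E -> E) : E -> E :=
  fun x => lie (Z c) (app11 f c X) x - f c x (lie (Z c) X x).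

Definition ext1 (w : oneform) c (X Y : E -> E) : E -> R := fun x =>
  'D_(X x) (fun y => w c y (Y y)) x - 'D_(Y x) (fun y => w c y (X y)) x
  - w c x (lie X Y x).

Definition ext2 (w : tensor02) c (X Y Z : E -> E) : E -> R := fun x =>
  'D_(X x) (fun y => w c y (Y y) (Z y)) x
  + 'D_(Y x) (fun y => w c y (Z y) (X y)) x
  + 'D_(Z x) (fun y => w c y (X y) (Y y)) x
  - w c x (lie X Y x) (Z x) - w c x (lie Y Z x) (X x)
  - w c x (lie Z X x) (Y x).

Definition wedge11 (w1 w2 : oneform) c x (u v : E) : R :=
  w1 c x u * w2 c x v - w1 c x v * w2 c x u.

Definition wedge12 (w : oneform) (F : tensor02) c x (u v z : E) : R :=
  w c x u * F c x v z + w c x v * F c x z u + w c x z * F c x u v.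

Definition is_killing (g : tensor02) (Z : vfield) :=
  forall c X Y x, local_vf c X -> local_vf c Y -> cimg M c x ->
    'D_(Z c x) (fun y => g c y (X y) (Y y)) x
    - g c x (lie (Z c) X x) (Y x) - g c x (X x) (lie (Z c) Y x) = 0.

(* An affine connection is given by its Christoffel symbols in each chart,
   [G c x u v] being the covariant derivative at x of the constant field v in
   the direction u; the second order term is the classical inhomogeneous term
   of their transformation law. *)
Definition is_connection (G : tensor12) :=
  [/\ forall c x u, cimg M c x -> linear (G c x u) /\ linear (G c x ^~ u),
      forall c u v, smooth_on (cimg M c) (fun x => G c x u v)
    & forall c d x u v, overlap c d x ->
        G d (transition c d x) (push c d x u) (push c d x v) =
        push c d x (G c x u v) - 'D_u (fun y => push c d y v) x].

Definition nabla (G : tensor12) c (X Y : E -> E) : E -> E :=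
  fun x => 'D_(X x) Y x + G c x (X x) (Y x).

(* (nabla_X f) Y *)
Definition nabla11 (G : tensor12) (f : tensor11) c (X Y : E -> E) : E -> E :=
  fun x => nabla G c X (app11 f c Y) x - f c x (nabla G c X Y x).

Definition has_torsion (G T : tensor12) :=
  forall c X Y x, local_vf c X -> local_vf c Y -> cimg M c x ->
    nabla G c X Y x - nabla G c Y X x - lie X Y x = T c x (X x) (Y x).

Definition metric_connection (g : tensor02) (G : tensor12) :=
  is_connection G /\
  forall c X Y Z x, local_vf c X -> local_vf c Y -> local_vf c Z ->
    cimg M c x ->
    'D_(X x) (fun y => g c y (Y y) (Z y)) x =
    g c x (nabla G c X Y x) (Z x) + g c x (Y x) (nabla G c X Z x).

Definition levi_civita (g : tensor02) (G : tensor12) :=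
  metric_connection g G /\ has_torsion G (fun _ _ _ _ => 0).

Definition skew_tensor12 (g : tensor02) (T : tensor12) :=
  forall c x u v w, cimg M c x ->
    g c x (T c x u v) w = - g c x (T c x v u) w /\
    g c x (T c x u v) w = - g c x (T c x u w) v.

Definition skew_torsion_connection (g : tensor02) (G T : tensor12) :=
  [/\ metric_connection g G, is_tensor12 T, has_torsion G T
    & skew_tensor12 g T].

Definition parallel11 (G : tensor12) (f : tensor11) :=
  forall c X Y x, local_vf c X -> local_vf c Y -> cimg M c x ->
    nabla11 G f c X Y x = 0.

Definition hermitian_connection (h : tensor02) (J : 'I_3 -> tensor11)
    (G : tensor12) :=
  metric_connection h G /\ forall i, parallel11 G (J i).

Definition nijenhuis (J : tensor11) c (X Y : E -> E) : E -> E := fun x =>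
  lie (app11 J c X) (app11 J c Y) x + J c x (J c x (lie X Y x))
  - J c x (lie (app11 J c X) Y x) - J c x (lie X (app11 J c Y) x).

Definition almost_hermitian (h : tensor02) (J : tensor11) :=
  [/\ is_tensor11 J,
      forall c x u, cimg M c x -> J c x (J c x u) = - u
    & forall c x u v, cimg M c x -> h c x (J c x u) (J c x v) = h c x u v].

(* Integrability is the vanishing of the Nijenhuis tensor. *)
Definition integrable (J : tensor11) :=
  forall c X Y x, local_vf c X -> local_vf c Y -> cimg M c x ->
    nijenhuis J c X Y x = 0.

Definition hyperhermitian (h : tensor02) (J : 'I_3 -> tensor11) :=
  [/\ is_metric h,
      forall i, almost_hermitian h (J i) /\ integrable (J i)
    & forall c x u, cimg M c x ->
        J 0 c x (J 1 c x u) = J 2%:R c x u /\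
        J 2%:R c x u = - J 1 c x (J 0 c x u)].

Definition HKT (h : tensor02) (J : 'I_3 -> tensor11) :=
  hyperhermitian h J /\
  exists G T, skew_torsion_connection h G T /\ forall i, parallel11 G (J i).

End Tensors.

(* The indices 1, 2, 3 are the elements 0, 1, 2 of 'I_3. *)
Definition even_perm3 (i j k : 'I_3) : bool :=
  (i : nat, j : nat, k : nat) \in [:: (0, 1, 2); (1, 2, 0); (2, 0, 1)]%N.

Record contact3 {R : realType} {m : nat} (M : manifold R m) := Contact3 {
  ac_phi : 'I_3 -> tensor11 M;
  ac_xi : 'I_3 -> vfield M;
  ac_eta : 'I_3 -> oneform M;
  ac_g : tensor02 M
}.

Section Contact.
Context {R : realType} {m : nat} (M : manifold R m) (S : contact3 M).
Local Notation E := 'rV[R]_m.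
Local Notation g := (ac_g S).
Local Notation phi := (ac_phi S).
Local Notation xi := (ac_xi S).
Local Notation eta := (ac_eta S).

Definition almost_contact_metric (i : 'I_3) :=
  [/\ [/\ is_tensor11 (phi i), is_vfield (xi i), is_oneform (eta i)
        & is_metric g],
      forall c x u, cimg M c x ->
        phi i c x (phi i c x u) = - u + eta i c x u *: xi i c x,
      forall c x, cimg M c x -> eta i c x (xi i c x) = 1
    & forall c x u v, cimg M c x ->
        g c x (phi i c x u) (phi i c x v) =
        g c x u v - eta i c x u * eta i c x v].

Definition almost_3contact_metric :=
  (forall i, almost_contact_metric i) /\
  (forall i j k, even_perm3 i j k -> forall c x, cimg M c x ->
    [/\ forall u, phi k c x u =
          phi i c x (phi j c x u) - eta j c x u *: xi i c x /\
          phi k c x u = - phi j c x (phi i c x u) + eta i c x u *: xi j c x,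
        xi k c x = phi i c x (xi j c x) /\ xi k c x = - phi j c x (xi i c x)
      & forall u, eta k c x u = eta i c x (phi j c x u) /\
          eta k c x u = - eta j c x (phi i c x u)]).

Definition Phi (i : 'I_3) : tensor02 M := fun c x u v => g c x u (phi i c x v).

Definition Nphi (i : 'I_3) c (X Y : E -> E) : E -> E := fun x =>
  lie (app11 (phi i) c X) (app11 (phi i) c Y) x
  + phi i c x (phi i c x (lie X Y x))
  - phi i c x (lie (app11 (phi i) c X) Y x)
  - phi i c x (lie X (app11 (phi i) c Y) x)
  + ext1 (eta i) c X Y x *: xi i c x.

Definition Nphi3 (i : 'I_3) c (X Y Z : E -> E) : E -> R :=
  fun x => g c x (Nphi i c X Y x) (Z x).

(* X is a section of the horizontal distribution over the domain of c. *)
Definition horizontal c (X : E -> E) :=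
  local_vf c X /\ forall i x, cimg M c x -> eta i c x (X x) = 0.

Definition Aij (i j : 'I_3) c (X Y : E -> E) : E -> R := fun x =>
  g c x (lieD11 (xi j) (phi i) c X x) (Y x)
  + ext1 (eta j) c X (app11 (phi i) c Y) x
  + ext1 (eta j) c (app11 (phi i) c X) Y x.

Definition reeb_killing_function (beta : M -> R) :=
  [/\ smooth_function beta,
      forall i c X Y x, horizontal c X -> horizontal c Y -> cimg M c x ->
        Aij i i c X Y x = 0
    & forall i j k, even_perm3 i j k ->
      forall c X Y x, horizontal c X -> horizontal c Y -> cimg M c x ->
        Aij i j c X Y x = beta (par M c x) * Phi k c x (X x) (Y x) /\
        - Aij j i c X Y x = beta (par M c x) * Phi k c x (X x) (Y x)].

Definition NdPhi (i : 'I_3) c (X Y Z : E -> E) : E -> R := fun x =>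
  Nphi3 i c X Y Z x
  - ext2 (Phi i) c (app11 (phi i) c X) (app11 (phi i) c Y)
      (app11 (phi i) c Z) x.

Definition canonical_a3cm (beta : M -> R) :=
  [/\ forall i c X Y Z x, horizontal c X -> horizontal c Y ->
        horizontal c Z -> cimg M c x ->
        Nphi3 i c X Y Z x = - Nphi3 i c Y X Z x /\
        Nphi3 i c X Y Z x = - Nphi3 i c X Z Y x,
      forall i, is_killing g (xi i),
      forall i j c X Y Z x, horizontal c X -> horizontal c Y ->
        horizontal c Z -> cimg M c x ->
        NdPhi i c X Y Z x = NdPhi j c X Y Z x
    & reeb_killing_function beta].

Definition canonical_connection (beta : M -> R) (G T : tensor12 M) :=
  skew_torsion_connection g G T /\
  forall i j k, even_perm3 i j k ->
  forall c X Y x, local_vf c X -> local_vf c Y -> cimg M c x ->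
    nabla11 G (phi i) c X Y x =
    beta (par M c x) *: (eta k c x (X x) *: phi j c x (Y x)
                         - eta j c x (X x) *: phi k c x (Y x)).

Definition three_alpha_delta_sasaki (alpha delta : R) :=
  alpha != 0 /\
  forall i j k, even_perm3 i j k ->
  forall c X Y x, local_vf c X -> local_vf c Y -> cimg M c x ->
    ext1 (eta i) c X Y x =
    2 * alpha * Phi i c x (X x) (Y x)
    + 2 * (alpha - delta) * wedge11 (eta j) (eta k) c x (X x) (Y x).

End Contact.

Section SmoothTheory.
Context {R : realType}.
Implicit Types V W : normedModType R.

Lemma near_eq_differentiable V W (f g : V -> W) (x : V) :
  (\near x, f x = g x) -> differentiable f x -> differentiable g x.
Proof.
move=> fg df.
pose h := g - f.
have -> : g = f + h by rewrite /h addrC subrK.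
apply: differentiableD => //.
have h0 : \near x, h x = 0.
  by near=> y; rewrite /h !fctE (near fg y)// subrr.
have [c0 e0] : continuous (0 : V -> W) /\
    h \o shift x = cst (h x) + (0 : V -> W) +o_ 0 id.
  split; first exact: cst_continuous.
  apply/eqaddoP => _/posnumP[e]; rewrite (nbhs_singleton h0).
  have h1 : \forall y \near (0 : V), h (y + x) = 0.
    by move: h0; rewrite (near_shift 0) subr0.
  near=> y; rewrite !fctE /=.
  have -> : h (y + x) = 0 by near: y.
  by rewrite !addr0 subrr normr0 mulr_ge0.
apply/diff_locallyP.
have -> : ('d h x : V -> W) = \0 by apply: (@diff_unique _ _ _ h \0 x).
by split.
Unshelve. all: by end_near. Qed.

Lemma Ck_on_ext V W k (U : set V) (f g : V -> W) : open U ->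
  {in U, f =1 g} -> Ck_on k U f -> Ck_on k U g.
Proof.
move=> oU; elim: k f g => [|k IH] f g fg.
  move=> cf x Ux; rewrite /prop_for /continuous_at -(fg x) ?inE//.
  apply: cvg_trans (cf x Ux); apply: near_eq_cvg.
  by near=> y; apply: fg; rewrite inE; near: y; exact: open_nbhs_nbhs.
move=> [df Df]; split=> [x Ux|v].
  apply: near_eq_differentiable (df _ Ux).
  by near=> y; apply: fg; rewrite inE; near: y; exact: open_nbhs_nbhs.
apply: IH (Df v) => x; rewrite inE => Ux; apply: near_eq_derive.
by near=> y; apply: fg; rewrite inE; near: y; exact: open_nbhs_nbhs.
Unshelve. all: by end_near. Qed.

Lemma Ck_on_cst V W k (U : set V) (a : W) : Ck_on k U (cst a).
Proof.
elim: k a => [|k IH] a; first by move=> x _; exact: cst_continuous.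
split=> [x _|v]; first exact: differentiable_cst.
rewrite (_ : (fun _ => _) = cst 0); first exact: IH.
by apply/funext => x; rewrite derive_cst.
Qed.

Lemma Ck_onD V W k (U : set V) (f g : V -> W) : open U ->
  Ck_on k U f -> Ck_on k U g -> Ck_on k U (f + g).
Proof.
move=> oU; elim: k f g => [|k IH] f g.
  by move=> cf cg x Ux; apply: cvgD; [exact: cf|exact: cg].
move=> [df Df] [dg Dg]; split=> [x Ux|v].
  by apply: differentiableD; [exact: df|exact: dg].
apply: (@Ck_on_ext _ _ _ _ ((fun x => 'D_v f x) + (fun x => 'D_v g x))) => //.
  move=> x; rewrite inE => Ux; rewrite deriveD//.
    by apply/diff_derivable/df.
  by apply/diff_derivable/dg.
by apply: IH; [exact: Df|exact: Dg].
Qed.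

Lemma Ck_on_linear_comp V W (W' : normedModType R) k (U : set V) (f : V -> W)
    (B : {linear W -> W'}) : open U -> continuous B ->
  Ck_on k U f -> Ck_on k U (B \o f).
Proof.
move=> oU cB; elim: k f => [|k IH] f.
  by move=> cf x Ux; apply: continuous_comp; [exact: cf|exact: cB].
move=> [df Df]; have dB y : differentiable B y by exact: linear_differentiable.
split=> [x Ux|v]; first by apply: differentiable_comp => //; exact: df.
apply: (@Ck_on_ext _ _ _ _ (B \o (fun x => 'D_v f x))) => //; last by apply: IH; exact: Df.
move=> x; rewrite inE => Ux /=.
have dfx := df _ Ux.
by rewrite !deriveE//; [rewrite [in RHS]diff_comp//= diff_lin|exact: differentiable_comp].
Qed.

Lemma Ck_on_comp_linear V (V' : normedModType R) W k (U : set V) (f : V -> W)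
    (L : {linear V' -> V}) : open U -> continuous L ->
  Ck_on k U f -> Ck_on k (L @^-1` U) (f \o L).
Proof.
move=> oU cL; have oLU : open (L @^-1` U) by apply: open_comp => // x _; exact: cL.
elim: k f => [|k IH] f.
  by move=> cf x Ux; apply: continuous_comp; [exact: cL|exact: cf].
move=> [df Df]; have dL y : differentiable L y by exact: linear_differentiable.
split=> [x Ux|v]; first by apply: differentiable_comp => //; exact: df.
apply: (@Ck_on_ext _ _ _ _ ((fun x => 'D_(L v) f x) \o L)) => //; last by apply: IH; exact: Df.
move=> x; rewrite inE => Ux /=.
have dfx := df _ Ux.
by rewrite !deriveE//; [rewrite [in RHS]diff_comp//= diff_lin|exact: differentiable_comp].
Qed.

Lemma Ck_on_subset V W k (U U' : set V) (f : V -> W) :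
  U' `<=` U -> Ck_on k U f -> Ck_on k U' f.
Proof.
move=> UU; elim: k f => [|k IH] f; first by move=> cf x /UU; exact: cf.
by move=> [df Df]; split=> [x /UU|v]; [exact: df|apply: IH; exact: Df].
Qed.

Lemma Ck_on_linear V W k (U : set V) (L : {linear V -> W}) : continuous L ->
  Ck_on k U L.
Proof.
move=> cL; case: k => [|k]; first by move=> x _; exact: cL.
split=> [x _|v]; first exact: linear_differentiable.
rewrite (_ : (fun _ => _) = cst (L v)); first exact: Ck_on_cst.
by apply/funext => x; rewrite deriveE ?diff_lin//; exact: linear_differentiable.
Qed.

End SmoothTheory.

Section RowMx.
Context {R : realType} {m n : nat}.

Definition rowl (u : 'rV[R]_m) : 'rV[R]_(m + n) := row_mx u 0.
Definition rowr (u : 'rV[R]_n) : 'rV[R]_(m + n) := row_mx 0 u.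

Fact rowl_linear : linear rowl.
Proof. by move=> a u v; rewrite /rowl scale_row_mx add_row_mx scaler0 addr0. Qed.
HB.instance Definition _ := GRing.isLinear.Build R _ _ _ rowl rowl_linear.

Fact rowr_linear : linear rowr.
Proof. by move=> a u v; rewrite /rowr scale_row_mx add_row_mx scaler0 addr0. Qed.
HB.instance Definition _ := GRing.isLinear.Build R _ _ _ rowr rowr_linear.

Lemma continuous_rowl : continuous rowl.
Proof.
move=> u A /nbhs_ballP[e /= e0 eA].
apply/nbhs_ballP; exists e => //= v [_ uv]; apply: eA; split => // i j.
rewrite !mxE; case: splitP => k _; first exact: uv.
by rewrite !mxE; exact: ballxx.
Qed.

Lemma continuous_rowr : continuous rowr.
Proof.
move=> u A /nbhs_ballP[e /= e0 eA].
apply/nbhs_ballP; exists e => //= v [_ uv]; apply: eA; split => // i j.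
rewrite !mxE; case: splitP => k _; last exact: uv.
by rewrite !mxE; exact: ballxx.
Qed.

Lemma rowlr u v : rowl u + rowr v = row_mx u v.
Proof. by rewrite /rowl /rowr add_row_mx addr0 add0r. Qed.

End RowMx.

(* The product manifold M x R^+. *)
Section Cone.
Context {R : realType} {m : nat} (M : manifold R m).

Definition posR : set R := [set r : R | 0 < r].
Definition cone_space := (M * set_type posR)%type.
HB.instance Definition _ := Topological.on cone_space.

Definition mpart (y : 'rV[R]_(m + 1)) : 'rV[R]_m := lsubmx y.
Definition rpart (y : 'rV[R]_(m + 1)) : R := rsubmx y 0 0.

Definition one_posR : set_type posR := exist _ 1 (mem_set (ltr01 : posR 1)).
(* [r] as a point of the half-line, a junk value if r <= 0. *)
Definition to_posR (r : R) : set_type posR := insubd one_posR r.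

Definition cone_cdom (c : chart M) : set cone_space := [set q | cdom M c q.1].
Definition cone_cimg (c : chart M) : set 'rV[R]_(m + 1) :=
  [set y | cimg M c (mpart y) /\ 0 < rpart y].
Definition cone_crd (c : chart M) (q : cone_space) : 'rV[R]_(m + 1) :=
  row_mx (crd M c q.1) (const_mx (val q.2)).
Definition cone_par (c : chart M) (y : 'rV[R]_(m + 1)) : cone_space :=
  (par M c (mpart y), to_posR (rpart y)).

Lemma posR_gt0 (s : set_type posR) : 0 < val s.
Proof. by case: s => r /= /set_mem. Qed.

Lemma val_to_posR r : 0 < r -> val (to_posR r) = r.
Proof. by move=> r0; rewrite /to_posR val_insubd mem_set. Qed.

Lemma to_posRK s : to_posR (val s) = s.
Proof. by apply: val_inj; rewrite val_to_posR// posR_gt0. Qed.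

Lemma mpart_row_mx u v : mpart (row_mx u v) = u.
Proof. exact: row_mxKl. Qed.

Lemma rpart_row_mx u v : rpart (row_mx u v) = v 0 0.
Proof. by rewrite /rpart row_mxKr. Qed.

Lemma row_mpart_rpart y : row_mx (mpart y) (const_mx (rpart y)) = y.
Proof.
rewrite -[RHS]hsubmxK; congr row_mx; apply/matrixP => i j.
by rewrite !mxE !ord1 /rpart mxE.
Qed.

Lemma continuous_mpart : continuous mpart.
Proof. exact: continuous_lsubmx. Qed.

Lemma continuous_rpart : continuous rpart.
Proof.
move=> y; apply: (@continuous_comp _ _ _ rsubmx (fun z => z 0 0)).
  exact: continuous_rsubmx.
exact: coord_continuous.
Qed.

Lemma continuous_val_posR : continuous (val : set_type posR -> R).
Proof. exact: (@initial_continuous (set_type posR) R val). Qed.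

Lemma continuous_to_posR r : 0 < r -> {for r, continuous to_posR}.
Proof.
move=> r0 U [B [[W oW <-] Ws] WU].
have Wr : W r by rewrite -(val_to_posR r0).
suff : \forall t \near r, U (to_posR t) by [].
near=> t; apply: WU => /=.
have t0 : 0 < t by near: t; exact: lt_nbhsr.
rewrite set_valE val_to_posR//.
by near: t; exact: open_nbhs_nbhs.
Unshelve. all: by end_near. Qed.

Lemma continuous_row_mx_const (u : cone_space -> 'rV[R]_m) (s : cone_space -> R) q :
  {for q, continuous u} -> {for q, continuous s} ->
  {for q, continuous (fun q => row_mx (u q) (const_mx (s q)) : 'rV[R]_(m + 1))}.
Proof.
move=> cu cs.
have -> : (fun q => row_mx (u q) (const_mx (s q)) : 'rV[R]_(m + 1)) =
    (rowl \o u) + (fun q => s q *: rowr (const_mx 1)).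
  apply/funext => z; rewrite fctE /= -linearZ /= rowlr; congr row_mx.
  by apply/matrixP => i j; rewrite !mxE mulr1.
apply: cvgD; last by apply: cvgZr_tmp.
by apply: continuous_comp; [exact: cu|exact: continuous_rowl].
Qed.

Lemma cone_hausdorff : hausdorff_space cone_space.
Proof.
rewrite open_hausdorff => -[p s] [q t] pqst.
have [pq|] := eqVneq p q.
  have st : val s != val t.
    by apply: contra_neq pqst => /val_inj ->; rewrite pq.
  have := @Rhausdorff R; rewrite open_hausdorff => /(_ _ _ st).
  move=> [[A B] /= [As Bt] [oA oB AB]].
  have cv : forall z, {for z, continuous (fun q : cone_space => val q.2)}.
    by move=> z; apply: continuous_comp; [exact: cvg_snd|exact: continuous_val_posR].
  exists ((fun q : cone_space => val q.2) @^-1` A,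
          (fun q : cone_space => val q.2) @^-1` B).
    by move: As Bt; rewrite !inE.
  split; [by apply: open_comp => // z _; exact: cv
         |by apply: open_comp => // z _; exact: cv|].
  by rewrite -preimage_setI (eqP AB) preimage_set0.
move=> pq; have := @mhausdorff _ _ M; rewrite open_hausdorff => /(_ _ _ pq).
move=> [[A B] /= [Ap Bq] [oA oB AB]].
exists ((fst : cone_space -> M) @^-1` A, (fst : cone_space -> M) @^-1` B).
  by move: Ap Bq; rewrite !inE.
split; [by apply: open_comp => // z _; exact: cvg_fst
       |by apply: open_comp => // z _; exact: cvg_fst|].
by rewrite -preimage_setI (eqP AB) preimage_set0.
Qed.

Lemma cone_second_countable : @second_countable cone_space.
Proof.
have [B cB [oB Bc]] := msecond_countable M.
pose box (b : set M * (rat * rat)) : set cone_space :=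
  [set z | b.1 z.1 /\ ratr b.2.1 < val z.2 < ratr b.2.2].
exists (box @` (B `*` setT)).
  apply: (@card_le_trans _ _ _ (B `*` [set: rat * rat])); first exact: card_image_le.
  by apply: countableX.
split.
  move=> _ [[b [q1 q2]] /= [Bb _] <-].
  have -> : box (b, (q1, q2)) = (fst @^-1` b) `&`
      ((fun z : cone_space => val z.2) @^-1` `]ratr q1, ratr q2[%classic).
    by apply/seteqP; split => z; rewrite /box /= in_itv.
  apply: openI; apply: open_comp.
  - by move=> z _; exact: cvg_fst.
  - exact: oB.
  - by move=> z _; apply: continuous_comp; [exact: cvg_snd|exact: continuous_val_posR].
  - exact: interval_open.
move=> [p s] U [[V W] /= [pV [C [[D oD <-] Ds] DW]] VWU].
have [b [Bb bp] bV] := Bc p V pV.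
have /nbhs_ballP[e /= e0 eD] : nbhs (val s) D by exact: open_nbhs_nbhs.
have /rat_in_itvoo[q1] : val s - e < val s by rewrite ltrBlDr ltrDl.
rewrite in_itv /= => /andP[q1l q1r].
have /rat_in_itvoo[q2] : val s < val s + e by rewrite ltrDl.
rewrite in_itv /= => /andP[q2l q2r].
exists (box (b, (q1, q2))).
  by split; [exists (b, (q1, q2))|rewrite /box /= q1r q2l; split].
move=> [x t] /= [bx /andP[q1t q2t]]; apply: VWU; split; first exact: bV.
apply: DW; apply: eD; rewrite /ball /= distrC ltr_distl.
by rewrite (lt_trans q1l q1t) (lt_trans q2t q2r).
Qed.

Lemma cone_cdom_open c : open (cone_cdom c).
Proof.
apply: (@open_comp _ _ fst (cdom M c)); last exact: cdom_open.
by move=> q _; exact: cvg_fst.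
Qed.

Lemma cone_cimg_open c : open (cone_cimg c).
Proof.
apply: (@openI _ (mpart @^-1` cimg M c) (rpart @^-1` [set r | 0 < r])).
  by apply: open_comp; [move=> y _; exact: continuous_mpart|exact: cimg_open].
by apply: open_comp; [move=> y _; exact: continuous_rpart|exact: open_gt].
Qed.

Lemma cone_crd_cimg c q : cone_cdom c q -> cone_cimg c (cone_crd c q).
Proof.
move=> cq; rewrite /cone_cimg /= mpart_row_mx rpart_row_mx mxE.
by split; [exact: crd_cimg|exact: posR_gt0].
Qed.

Lemma cone_par_cdom c y : cone_cimg c y -> cone_cdom c (cone_par c y).
Proof. by move=> [cy _]; exact: par_cdom. Qed.

Lemma cone_crdK c q : cone_cdom c q -> cone_par c (cone_crd c q) = q.
Proof.
case: q => p s /= cp; rewrite /cone_par mpart_row_mx rpart_row_mx mxE /=.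
by rewrite crdK// to_posRK.
Qed.

Lemma cone_parK c y : cone_cimg c y -> cone_crd c (cone_par c y) = y.
Proof.
move=> [cy y0]; rewrite /cone_crd /= parK// val_to_posR//.
exact: row_mpart_rpart.
Qed.

Lemma cone_crd_continuous c q : cone_cdom c q ->
  {for q, continuous (cone_crd c)}.
Proof.
move=> cq; apply: continuous_row_mx_const.
  by apply: continuous_comp; [exact: cvg_fst|exact: crd_continuous].
by apply: continuous_comp; [exact: cvg_snd|exact: continuous_val_posR].
Qed.

Lemma cone_par_continuous c y : cone_cimg c y ->
  {for y, continuous (cone_par c)}.
Proof.
move=> [cy y0].
have h1 : (fun z => par M c (mpart z)) @ y --> par M c (mpart y).
  by apply: continuous_comp; [exact: continuous_mpart|exact: par_continuous].
have h2 : (fun z => to_posR (rpart z)) @ y --> to_posR (rpart y).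
  by apply: continuous_comp; [exact: continuous_rpart|exact: continuous_to_posR].
exact: cvg_pair h1 h2.
Qed.

Lemma cone_cover q : exists c, cone_cdom c q.
Proof. exact: atlas_cover. Qed.

Lemma cone_transition_smooth c d :
  smooth_on (cone_cimg c `&` cone_par c @^-1` cone_cdom d)
            (cone_crd d \o cone_par c).
Proof.
move=> k; set V := (X in Ck_on _ X).
pose U := cimg M c `&` par M c @^-1` cdom M d.
have oU : open U.
  rewrite openE => x [cx dx].
  apply: filterI; first by apply: open_nbhs_nbhs; split => //; exact: cimg_open.
  apply: (par_continuous cx); apply: open_nbhs_nbhs; split => //.
  exact: cdom_open.
pose f : 'rV[R]_(m + 1) -> 'rV[R]_(m + 1) :=
  (rowl \o ((crd M d \o par M c) \o lsubmx)) + (rowr \o rsubmx).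
have oLU : open (lsubmx @^-1` U : set 'rV[R]_(m + 1)).
  by apply: open_comp => // y _; exact: continuous_lsubmx.
have VU : V = (lsubmx @^-1` U) `&` rpart @^-1` [set r | 0 < r].
  by apply/seteqP; split => y; rewrite /V /U /cone_cimg /cone_cdom /=; tauto.
have oV : open V.
  rewrite VU; apply: openI => //.
  by apply: open_comp; [move=> y _; exact: continuous_rpart|exact: open_gt].
apply: (@Ck_on_ext _ _ _ _ _ f) => //.
  move=> y; rewrite inE => -[[_ y0] _].
  rewrite /f fctE /= rowlr /cone_crd /= val_to_posR//; congr row_mx.
  by apply/matrixP => i j; rewrite !mxE !ord1 /rpart mxE.
apply: (@Ck_on_subset _ _ _ _ (lsubmx @^-1` U)); first by rewrite VU => y [].
apply: Ck_onD => //.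
  apply: Ck_on_linear_comp => //; first exact: continuous_rowl.
  apply: Ck_on_comp_linear => //; first exact: continuous_lsubmx.
  exact: transition_smooth.
apply: Ck_on_linear_comp => //; first exact: continuous_rowr.
by apply: Ck_on_linear; exact: continuous_rsubmx.
Qed.

Definition cone : manifold R (m + 1) := {|
  mspace := cone_space;
  mhausdorff := cone_hausdorff;
  msecond_countable := cone_second_countable;
  chart := chart M;
  cdom := cone_cdom;
  cimg := cone_cimg;
  crd := cone_crd;
  par := cone_par;
  cdom_open := cone_cdom_open;
  cimg_open := cone_cimg_open;
  crd_cimg := cone_crd_cimg;
  par_cdom := cone_par_cdom;
  crdK := cone_crdK;
  parK := cone_parK;
  crd_continuous := cone_crd_continuous;
  par_continuous := cone_par_continuous;
  atlas_cover := cone_cover;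
  transition_smooth := cone_transition_smooth
|}.

End Cone.

Section ConeGeometry.
Context {R : realType} {m : nat} (M : manifold R m).
Local Notation E1 := 'rV[R]_(m + 1).

(* In the chart c of the cone, a tangent vector w at the point of coordinates y
   is [mpart w] (tangent to M) plus [rpart w] times d/dr; the point has
   coordinates [mpart y] in M and radius [rpart y]. *)
Definition cone_metric (a : R) (g : tensor02 M) : tensor02 (cone M) :=
  fun c (y v w : E1) =>
    a ^+ 2 * rpart y ^+ 2 * g c (mpart y) (mpart v) (mpart w)
    + rpart v * rpart w.

Definition cone_lift (T : tensor12 M) : tensor12 (cone M) :=
  fun c (y v w : E1) => row_mx (T c (mpart y) (mpart v) (mpart w)) 0.

(* D is the appendant connection, with cone constant a, of the metric
   connection on (M, g) with skew torsion T. *)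
Definition appendant (a : R) (g : tensor02 M) (T : tensor12 M)
    (D : tensor12 (cone M)) :=
  exists2 L, levi_civita (cone_metric a g) L &
    forall c (y v w : E1), cimg (cone M) c y ->
      D c y v w = L c y v w + 2^-1 *: cone_lift T c y v w.

(* For w = u + s d/dr with u = V + eta_i(u) xi_i and V orthogonal to xi_i, and
   up to the opposite sign for the third structure,
   J_i w = s/(ar) xi_i - phi_i V - eta_i(u) a r d/dr. *)
Definition coneJ (a : R) (S : contact3 M) (i : 'I_3) : tensor11 (cone M) :=
  fun c (y w : E1) =>
    let x := mpart y in let r := rpart y in
    let u := mpart w in let s := rpart w in
    let V := u - ac_eta S i c x u *: ac_xi S i c x in
    (if i == 2%:R then -1 else 1) *:
      row_mx ((s / (a * r)) *: ac_xi S i c x - ac_phi S i c x V)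
             (const_mx (- (ac_eta S i c x u * (a * r)))).

End ConeGeometry.

(* Main.v *)
(* Two metric connections with skew torsion differ by half the difference of
   their torsions. So nabla' = nabla + (b/2) Theta, where Theta is the 2-form
   with values in vectors that represents the sum of the eta_i /\ Phi_i, and
   the formula for nabla phi_i becomes the Sasaki-like identity
     (nabla'_X phi_i) Y = a (g(X,Y) xi_i - eta_i(Y) X),
   which forces nabla'_X xi_i = - a phi_i X. The Levi-Civita connection of the
   cone is explicit, the appendant connection is the corresponding warped
   product extension of nabla', and these two identities say exactly that it
   parallelizes J_i.

   The torsion of the appendant connection is a 3-form on the cone, so for the
   HKT property only the integrability of J_i is missing. As J_i is parallel,
   its Nijenhuis tensor is algebraic in T', and it vanishes when T' is a
   combination of Theta and of the 3-form eta_1 /\ eta_2 /\ eta_3. On a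
   3-(alpha,delta)-Sasaki manifold T has this form: eta_i(T) is given by
   d eta_i, and d(d eta_1) = 0 says that the horizontal part of T is killed by
   the derivation induced by phi_1, hence is zero. *)
Require Import Defs.
From HB Require Import structures.
From mathcomp Require Import all_boot all_order all_algebra.
From mathcomp Require Import all_classical all_reals all_analysis.
From mathcomp Require Import ring lra.

Set Implicit Arguments.
Unset Strict Implicit.
Unset Printing Implicit Defensive.

Import Order.TTheory GRing.Theory Num.Theory.
Import numFieldNormedType.Exports.

Local Open Scope classical_set_scope.
Local Open Scope ring_scope.

(** * Smooth maps and directional derivatives *)

Section LinearFor.
Context {K : pzRingType} {V : lmodType K} {W : zmodType} {s : GRing.Scale.law K W}.
Variables (f : V -> W) (lf : linear_for s f).

(** Tensor components are linear only through a proof valid on the chart image. Packing that proof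
    on the spot opens the library of linear maps; the law [s] covers vector-valued and scalar-valued
    maps at once. *)
Let F : {linear V -> W | s} := HB.pack f (GRing.isLinear.Build K V W s f lf).

Lemma linear_forD u v : f (u + v) = f u + f v.
Proof. exact: (linearD F). Qed.
Lemma linear_forB u v : f (u - v) = f u - f v.
Proof. exact: (linearB F). Qed.
Lemma linear_forN u : f (- u) = - f u.
Proof. exact: (linearN F). Qed.
Lemma linear_for0 : f 0 = 0.
Proof. exact: (linear0 F). Qed.
Lemma linear_forZ k u : f (k *: u) = s k (f u).
Proof. exact: (linearZ_LR F). Qed.
Lemma linear_for_sum I (r : seq I) P (E : I -> V) :
  f (\sum_(i <- r | P i) E i) = \sum_(i <- r | P i) f (E i).
Proof. exact: (linear_sum F). Qed.
End LinearFor.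

Section Calculus.
Context {R : realType}.
Implicit Types V W : normedModType R.

(** Registering scaling as a bilinear map gives its differential by the general bilinear rule, and
    from it the Leibniz rule [derive_scale]. *)
Lemma scale_is_bilinear W :
  bilinear_for (GRing.Scale.Law.clone _ _ *:%R _) (GRing.Scale.Law.clone _ _ *:%R _)
    (@GRing.scale R W).
Proof.
split=> [u'|u] a x y /=; first by rewrite scalerDl scalerA.
by rewrite scalerDr !scalerA mulrC.
Qed.
HB.instance Definition _ W := bilinear_isBilinear.Build R R W W _ _
  (@GRing.scale R W) (@scale_is_bilinear W).

Lemma is_diff_scale V W (f df : V -> R) (g dg : V -> W) x :
  is_diff x f df -> is_diff x g dg ->
  is_diff x (fun y => f y *: g y) (fun v => f x *: dg v + df v *: g x).
Proof.
move=> dfx dgx.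
have sc : continuous (fun p : R * W => p.1 *: p.2) by exact: scale_continuous.
have ds : is_diff (f x, g x) (fun p : R * W => p.1 *: p.2)
    (fun q => f x *: q.2 + q.1 *: g x).
  apply: DiffDef; last by rewrite (diff_bilin (f := @GRing.scale R W)).
  exact: (differentiable_bilin (f := @GRing.scale R W)).
by apply: is_diff_eq (is_diff_comp (is_diff_pair dfx dgx) ds) _.
Qed.

Lemma differentiable_scale V W (f : V -> R) (g : V -> W) x :
  differentiable f x -> differentiable g x ->
  differentiable (fun y => f y *: g y) x.
Proof.
move=> /differentiableP df /differentiableP dg.
by have [] := is_diff_scale df dg.
Qed.

Lemma derive_scale V W (f : V -> R) (g : V -> W) x v :
  differentiable f x -> differentiable g x ->
  'D_v (fun y => f y *: g y) x = f x *: 'D_v g x + 'D_v f x *: g x.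
Proof.
move=> df dg; rewrite !deriveE//; last exact: differentiable_scale.
move/differentiableP in df; move/differentiableP in dg.
by have [_ ->] := is_diff_scale df dg.
Qed.

Lemma derive_linear V W (f : V -> W) x : differentiable f x ->
  linear (fun v => 'D_v f x).
Proof. by move=> df a u v; rewrite !deriveE// linearP. Qed.

Lemma derive_linear_comp V W W' (B : {linear W -> W'}) (f : V -> W) x v :
  continuous B -> differentiable f x ->
  'D_v (fun y => B (f y)) x = B ('D_v f x).
Proof.
move=> cB df; have dB y : differentiable B y by exact: linear_differentiable.
by rewrite !deriveE//; [rewrite diff_comp//= diff_lin|exact: differentiable_comp].
Qed.

Lemma derive_comp_linear V V' W (L : {linear V' -> V}) (f : V -> W) x v :
  continuous L -> differentiable f (L x) ->
  'D_v (fun y => f (L y)) x = 'D_(L v) f (L x).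
Proof.
move=> cL df; have dL y : differentiable L y by exact: linear_differentiable.
by rewrite !deriveE//; [rewrite diff_comp//= diff_lin|exact: differentiable_comp].
Qed.

Lemma near_open V (U : set V) (P : V -> Prop) x :
  open U -> U x -> (forall y, U y -> P y) -> \forall y \near x, P y.
Proof. by move=> oU Ux UP; near=> y; apply: UP; near: y; exact: open_nbhs_nbhs.
Unshelve. all: by end_near. Qed.

Lemma derive_ext V W (U : set V) (f g : V -> W) x v : open U -> U x ->
  (forall y, U y -> f y = g y) -> 'D_v f x = 'D_v g x.
Proof. by move=> oU Ux fg; apply: near_eq_derive; exact: near_open fg. Qed.

Lemma smooth_differentiable V W (U : set V) (f : V -> W) x :
  smooth_on U f -> U x -> differentiable f x.
Proof. by move=> /(_ 1%N)[df _]; exact: df. Qed.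

Lemma smooth_derive V W (U : set V) (f : V -> W) v :
  smooth_on U f -> smooth_on U (fun x => 'D_v f x).
Proof. by move=> sf k; have [_ Df] := sf k.+1; exact: Df. Qed.

(** The Leibniz rule leaves one factor underived in each term, so the induction for products has to
    lower the order of that factor by one. *)
Lemma Ck_onS V W k (U : set V) (f : V -> W) : Ck_on k.+1 U f -> Ck_on k U f.
Proof.
elim: k f => [|k IH] f.
  by move=> [df _] x Ux; apply: differentiable_continuous; exact: df.
by move=> [df Df]; split=> // v; apply: IH; exact: Df.
Qed.

Section OpenSet.
Context {V : normedModType R} (U : set V) (oU : open U).

Lemma Ck_on_scale W k (f : V -> R) (g : V -> W) :
  Ck_on k U f -> Ck_on k U g -> Ck_on k U (fun x => f x *: g x).
Proof.
elim: k f g => [|k IH] f g.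
  by move=> cf cg x Ux; apply: cvgZ; [exact: cf|exact: cg].
move=> Cf Cg; have [df Df] := Cf; have [dg Dg] := Cg; split=> [x Ux|v].
  by apply: differentiable_scale; [exact: df|exact: dg].
apply: (@Ck_on_ext _ _ _ _ _
  ((fun x => f x *: 'D_v g x) + (fun x => 'D_v f x *: g x))) => //.
  by move=> x; rewrite inE => Ux; rewrite derive_scale//; [exact: df|exact: dg].
apply: Ck_onD => //; apply: IH => //; try exact: Ck_onS.
  exact: Dg.
exact: Df.
Qed.

Lemma smooth_ext W (f g : V -> W) :
  (forall x, U x -> f x = g x) -> smooth_on U f -> smooth_on U g.
Proof.
by move=> fg sf k; apply: Ck_on_ext (sf k) => // x; rewrite inE; exact: fg.
Qed.

Lemma smooth_cst W (a : W) : smooth_on U (fun _ => a).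
Proof. by move=> k; exact: Ck_on_cst. Qed.

Lemma smoothD W (f g : V -> W) :
  smooth_on U f -> smooth_on U g -> smooth_on U (fun x => f x + g x).
Proof. by move=> sf sg k; exact: (Ck_onD oU (sf k) (sg k)). Qed.

Lemma smooth_scale W (f : V -> R) (g : V -> W) :
  smooth_on U f -> smooth_on U g -> smooth_on U (fun x => f x *: g x).
Proof. by move=> sf sg k; exact: Ck_on_scale. Qed.

Lemma smoothM (f g : V -> R) :
  smooth_on U f -> smooth_on U g -> smooth_on U (fun x => f x * g x).
Proof. exact: (@smooth_scale R^o). Qed.

Lemma smoothZ W (a : R) (f : V -> W) :
  smooth_on U f -> smooth_on U (fun x => a *: f x).
Proof. by apply: smooth_scale; exact: smooth_cst. Qed.

Lemma smoothN W (f : V -> W) : smooth_on U f -> smooth_on U (fun x => - f x).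
Proof.
move=> /(smoothZ (-1)); apply: smooth_ext => x _; exact: scaleN1r.
Qed.

Lemma smoothB W (f g : V -> W) :
  smooth_on U f -> smooth_on U g -> smooth_on U (fun x => f x - g x).
Proof. by move=> sf sg; apply: smoothD => //; exact: smoothN. Qed.

Lemma smooth_sum W (I : Type) (r : seq I) (f : I -> V -> W) :
  (forall i, smooth_on U (f i)) -> smooth_on U (fun x => \sum_(i <- r) f i x).
Proof.
move=> sf; elim: r => [|i r IH].
  by apply: smooth_ext (smooth_cst 0) => x _; rewrite big_nil.
by apply: smooth_ext (smoothD (sf i) IH) => x _; rewrite big_cons.
Qed.

Lemma smooth_linear_comp W W' (B : {linear W -> W'}) (f : V -> W) :
  continuous B -> smooth_on U f -> smooth_on U (fun x => B (f x)).
Proof. by move=> cB sf k; exact: Ck_on_linear_comp. Qed.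

(** The derivative of 1/f is a product of two copies of 1/f, of class C^k by induction, and of
    -Df. *)
Lemma smooth_inv (f : V -> R) : (forall x, U x -> f x != 0) ->
  smooth_on U f -> smooth_on U (fun x => (f x)^-1).
Proof.
move=> f0 sf k; elim: k => [|k IH].
  by move=> x Ux; apply: cvgV; [exact: f0|exact: (sf 0%N)].
have df x : U x -> differentiable f x by exact: smooth_differentiable.
split=> [x Ux|v]; first by apply: differentiableV; [exact: df|exact: f0].
apply: (@Ck_on_ext _ _ _ _ _ (fun x => ((f x)^-1 * (f x)^-1) *: (- 'D_v f x))) => //.
  move=> x; rewrite inE => Ux; rewrite deriveV ?f0//; last first.
    by apply/diff_derivable/df.
  by rewrite scalerN scaleNr -exprVn expr2.
apply: (@Ck_on_scale R^o); first exact: (@Ck_on_scale R^o).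
exact: (smoothN (smooth_derive v sf)).
Qed.

End OpenSet.

Section Coordinates.
Context {V : normedModType R} (U : set V) (oU : open U) {p : nat}.
Implicit Types Y : V -> 'rV[R]_p.

Definition row_coord (j : 'I_p) (u : 'rV[R]_p) : R := u 0 j.
Fact row_coord_linear j : linear (row_coord j : _ -> R^o).
Proof. by move=> a u v; rewrite /row_coord !mxE. Qed.
HB.instance Definition _ j := GRing.isLinear.Build R _ _ _ (row_coord j)
  (@row_coord_linear j).

Lemma continuous_row_coord j : continuous (row_coord j).
Proof. exact: coord_continuous. Qed.

Lemma smooth_coord Y j : smooth_on U Y -> smooth_on U (fun x => Y x 0 j).
Proof. exact: (smooth_linear_comp oU (B := row_coord j) (@continuous_row_coord j)). Qed.

Lemma derive_coord Y x v j : differentiable Y x ->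
  'D_v (fun y => Y y 0 j) x = ('D_v Y x) 0 j.
Proof. exact: (derive_linear_comp (B := row_coord j) v (@continuous_row_coord j)). Qed.

(** Expansion in the standard basis: a family of linear maps evaluated at a moving vector becomes a
    finite sum of scalar functions times vector functions, to which the rules for [smooth_scale] and
    [derive_scale] apply. *)
Let Dx (W : lmodType R) (s : GRing.Scale.law R W) (f : 'rV[R]_p -> W) u :
  linear_for s f -> f u = \sum_j s (u 0 j) (f (delta_mx 0 j)).
Proof.
move=> lf; rewrite {1}(row_sum_delta u) (linear_for_sum lf).
by under eq_bigr do rewrite (linear_forZ lf).
Qed.

Lemma linear_smooth_apply W (f : V -> 'rV[R]_p -> W) Y :
  (forall x, U x -> linear (f x)) -> (forall u, smooth_on U (f^~ u)) ->
  smooth_on U Y -> smooth_on U (fun x => f x (Y x)).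
Proof.
move=> lf sf sY.
apply: (smooth_ext oU (f := fun x => \sum_j Y x 0 j *: f x (delta_mx 0 j))).
  by move=> x /lf lfx; rewrite [RHS](Dx _ lfx).
by apply: smooth_sum => // j; apply: smooth_scale => //; exact: smooth_coord.
Qed.

Lemma derive_linear_apply W (f : V -> 'rV[R]_p -> W) Y x v : U x ->
  (forall x, U x -> linear (f x)) -> (forall u, smooth_on U (f^~ u)) ->
  differentiable Y x ->
  'D_v (fun y => f y (Y y)) x = 'D_v (f^~ (Y x)) x + f x ('D_v Y x).
Proof.
move=> Ux lf sf dY.
have dfu u : differentiable (f^~ u) x by exact: smooth_differentiable (sf u) Ux.
rewrite (derive_ext (U := U) v (g := fun x => \sum_j Y x 0 j *: f x (delta_mx 0 j)))//; last first.
  by move=> y /lf lfy; rewrite [LHS](Dx _ lfy).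
rewrite [X in _ = X + _](derive_ext (U := U) v
  (g := fun y => \sum_j Y x 0 j *: f y (delta_mx 0 j)))//; last first.
  by move=> y /lf lfy; rewrite [LHS](Dx _ lfy).
have dYj j : differentiable (fun y => Y y 0 j) x.
  exact: (differentiable_comp dY (differentiable_coord (Y x) 0 j)).
have dsum (c : 'I_p -> V -> R) : (forall j, differentiable (c j) x) ->
    'D_v (fun y => \sum_j c j y *: f y (delta_mx 0 j)) x =
    \sum_j 'D_v (fun y => c j y *: f y (delta_mx 0 j)) x.
  move=> dc; rewrite -derive_sum.
    by congr ('D_v _ x); apply/funext => y; rewrite fct_sumE.
  by move=> j; apply/diff_derivable/differentiable_scale.
rewrite !dsum//.
rewrite [X in _ = _ + X](Dx _ (lf _ Ux)) -big_split /=.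
apply: eq_bigr => j _.
rewrite !derive_scale//.
by rewrite (derive_cst (Y x 0 j)) scale0r addr0 derive_coord.
Qed.

End Coordinates.

Section Bilinear.
Context {V : normedModType R} (U : set V) (oU : open U) {p q : nat}.
Context {W : normedModType R} (h : V -> 'rV[R]_p -> 'rV[R]_q -> W).
Hypothesis lhl : forall x u, U x -> linear (h x ^~ u).
Hypothesis lhr : forall x u, U x -> linear (h x u).
Hypothesis sh : forall u v, smooth_on U (fun x => h x u v).

Lemma derive_bilinear_apply Y Z x v : U x -> smooth_on U Y -> smooth_on U Z ->
  'D_v (fun y => h y (Y y) (Z y)) x =
  'D_v (fun y => h y (Y x) (Z x)) x + h x ('D_v Y x) (Z x) + h x (Y x) ('D_v Z x).
Proof.
move=> Ux sY sZ.
rewrite (derive_linear_apply oU (f := fun x u => h x (Y x) u))//.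
- congr (_ + _).
  apply: (derive_linear_apply oU (f := fun y u => h y u (Z x))) => //.
    by move=> y Uy; exact: lhl.
  exact: smooth_differentiable sY Ux.
- by move=> y Uy; exact: lhr.
- move=> u; apply: (linear_smooth_apply oU (f := fun x v => h x v u)) => //.
  by move=> y Uy; exact: lhl.
- exact: smooth_differentiable sZ Ux.
Qed.
End Bilinear.

End Calculus.

(** * Symmetry of second derivatives *)

Section Schwarz.
Context {R : realType} {V : normedModType R}.
Implicit Types (f : V -> R) (x u v w : V).

Lemma differentiable_addr f x w :
  differentiable f (x + w) -> differentiable (fun y => f (y + w)) x.
Proof.
move=> df; apply: (@differentiable_comp _ _ _ _ (fun y => y + w) f).
  by apply: differentiableD.
exact: df.
Qed.

Lemma derive_addr f x w v : 'D_v (fun y => f (y + w)) x = 'D_v f (x + w).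
Proof.
rewrite /derive; set d1 := fun h => _; set d2 := fun h => _.
suff -> : d1 = d2 by [].
by apply/funext => h; rewrite /d1 /d2 /= addrA.
Qed.

Lemma is_derive_line f x v (s : R) : differentiable f (s *: v + x) ->
  is_derive s 1 (fun t => f (t *: v + x)) ('D_v f (s *: v + x)).
Proof.
move=> df.
have dl : is_diff s (fun t => t *: v + x) (fun t => t *: v).
  have := is_diffD (is_diff_scalel s v) (is_diff_cst x s).
  by rewrite addr0.
have /differentiableP df' := df.
have [dfl dflE] := is_diff_comp dl df'.
apply: DeriveDef; first exact: diff_derivable.
by rewrite deriveE// dflE /= scale1r deriveE.
Qed.

Lemma mean_value_line f x v (h : R) : 0 < h ->
  (forall s, 0 <= s <= h -> differentiable f (s *: v + x)) ->
  exists2 s, 0 <= s <= h & f (h *: v + x) - f x = 'D_v f (s *: v + x) * h.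
Proof.
move=> h0 df.
have dl s : 0 <= s <= h ->
    is_derive s 1 (fun t => f (t *: v + x)) ('D_v f (s *: v + x)).
  by move=> /df; exact: is_derive_line.
have [| | |s] := @MVT R (fun t => f (t *: v + x)) (fun s => 'D_v f (s *: v + x)) 0 h.
- by [].
- move=> s; rewrite in_itv /= => /andP[s0 sh]; apply: dl.
  by rewrite !ltW.
- apply: derivable_within_continuous => s; rewrite in_itv /= => /dl.
  by case.
- rewrite in_itv /= => /andP[s0 sh]; rewrite scale0r add0r subr0 => ->.
  by exists s => //; rewrite !ltW.
Qed.

(** Two applications of the mean value theorem: first along u to [F], the increment of f in the
    direction v, then along v to the derivative of f in the direction u. *)
Lemma second_difference f x u v (h : R) : 0 < h ->
  (forall s t, 0 <= s <= h -> 0 <= t <= h ->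
     let y := s *: u + (t *: v + x) in
     differentiable f y /\ differentiable (fun y => 'D_u f y) y) ->
  exists s t, [/\ 0 <= s <= h, 0 <= t <= h &
    f (h *: u + (h *: v + x)) - f (h *: v + x) - f (h *: u + x) + f x =
    'D_v (fun y => 'D_u f y) (s *: u + (t *: v + x)) * h * h].
Proof.
move=> h0 df.
pose F y := f (y + h *: v) - f y.
have h00 : 0 <= (0 : R) <= h by rewrite lexx ltW.
have hh : 0 <= h <= h by rewrite lexx ltW.
have df0 s : 0 <= s <= h -> differentiable f (s *: u + x).
  by move=> sh; have [] := df s 0 sh h00; rewrite scale0r add0r.
have dfh s : 0 <= s <= h -> differentiable f (s *: u + x + h *: v).
  by move=> sh; have [] := df s h sh hh; rewrite [h *: v + x]addrC addrA.
have dF s : 0 <= s <= h -> differentiable F (s *: u + x).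
  move=> sh; apply: differentiableB; last exact: df0.
  by apply: differentiable_addr; exact: dfh.
have [s sh Fs] := mean_value_line h0 dF.
have DF : 'D_u F (s *: u + x) =
    'D_u f (h *: v + (s *: u + x)) - 'D_u f (s *: u + x).
  rewrite deriveB ?derive_addr 1?[h *: v + _]addrC//.
    by apply/diff_derivable/differentiable_addr; exact: dfh.
  by apply/diff_derivable; exact: df0.
have [|t th Dt] := @mean_value_line (fun y => 'D_u f y) (s *: u + x) v h h0.
  by move=> t th; have [_] := df s t sh th; rewrite addrCA.
exists s, t; split => //.
rewrite [s *: u + _]addrCA -Dt -DF -Fs /F.
have -> : h *: u + x + h *: v = h *: u + (h *: v + x) by rewrite -addrA [x + _]addrC.
by rewrite [x + _]addrC; ring.
Qed.

(** The second difference of f is symmetric in u and v. Hence the two mixed derivatives agree at two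
    suitable points near x, and by continuity they differ at x by at most any e > 0. *)
Lemma schwarz (U : set V) f x u v : open U -> U x -> smooth_on U f ->
  'D_u (fun y => 'D_v f y) x = 'D_v (fun y => 'D_u f y) x.
Proof.
move=> oU Ux sf.
apply/eqP; rewrite -subr_eq0 -normr_le0; apply/ler_addgt0Pr => e e0.
rewrite add0r.
pose F a b y := 'D_a (fun z => 'D_b f z) y.
have cF a b : {for x, continuous (F a b)}.
  exact: (smooth_derive a (smooth_derive b sf)) 0%N x Ux.
rewrite -/(F u v x) -/(F v u x).
have e2 : 0 < e / 2 by rewrite divr_gt0.
have nF a b : \forall y \near x, `|F a b x - F a b y| < e / 2.
  by move/cvgrPdist_lt : (cF a b); exact.
have nU : \forall y \near x, U y by exact: open_nbhs_nbhs.
have /nbhs_normP[d /= d0 dP] : \forall y \near x, [/\ U y,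
    `|F u v x - F u v y| < e / 2 & `|F v u x - F v u y| < e / 2].
  apply: filterS3 nU (nF u v) (nF v u) => y ? ? ?.
  by split.
(* The parallelogram on hu and hv at x must stay in the ball of radius d. The summand 1 in the
   denominator of [h] keeps it positive even for u = v = 0. *)
have [h h0 near] : exists2 h, 0 < h & forall s t, 0 <= s <= h -> 0 <= t <= h ->
    ball_ Num.norm x d (s *: u + (t *: v + x)).
  have uv0 : 0 < `|u| + `|v| + 1 by rewrite ltr_pwDr// addr_ge0.
  exists (d / (`|u| + `|v| + 1)) => [|s t]; first by rewrite divr_gt0.
  set h := d / _ => /andP[s0 sh] /andP[t0 th].
  rewrite /ball_ /= addrA opprD addrCA subrr addr0 normrN.
  apply: (@le_lt_trans _ _ (h * (`|u| + `|v|))).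
    rewrite (le_trans (ler_normD _ _))// !normrZ !ger0_norm// mulrDr lerD//.
      by rewrite ler_wpM2r.
    by rewrite ler_wpM2r.
  by rewrite /h mulrAC ltr_pdivrMr// ltr_pM2l// ltrDl.
have dU a y : U y -> differentiable f y /\ differentiable (fun z => 'D_a f z) y.
  move=> Uy; split; first exact: smooth_differentiable sf Uy.
  exact: smooth_differentiable (smooth_derive a sf) Uy.
have sd a b : (forall s t, 0 <= s <= h -> 0 <= t <= h -> U (s *: a + (t *: b + x))) ->
  exists s t, [/\ 0 <= s <= h, 0 <= t <= h &
    f (h *: a + (h *: b + x)) - f (h *: b + x) - f (h *: a + x) + f x =
    F b a (s *: a + (t *: b + x)) * h * h].
  move=> abU; apply: second_difference => // s t sh th; apply: dU; exact: abU.
clearbody F; have [|s [t [sh th E1]]] := sd u v.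
  by move=> s t sh th; have [] := dP _ (near _ _ sh th).
have [|t' [s' [th' sh' E2]]] := sd v u.
  by move=> t1 s1 th1 sh1; rewrite addrCA; have [] := dP _ (near _ _ sh1 th1).
have [_ _ B1] := dP _ (near _ _ sh th).
have [_ B2 _] := dP _ (near _ _ sh' th').
(* Multiplied by h^2, both sides equal the same second difference. *)
have E : F v u (s *: u + (t *: v + x)) = F u v (s' *: u + (t' *: v + x)).
  have hn : h * h != 0 by rewrite mulf_neq0 ?gt_eqF.
  apply: (mulIf hn); rewrite !mulrA -E1 [s' *: u + _]addrCA -E2.
  by rewrite [h *: v + (h *: u + x)]addrCA; congr (_ + _); rewrite addrAC.
rewrite E in B1; move: B1 B2.
move: (F u v x) (F v u x) (F u v _) => A B C B1 B2.
have -> : A - B = (A - C) - (B - C) by ring.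
by rewrite (le_trans (ler_normB _ _))// [e]splitr lerD// ltW.
Qed.

End Schwarz.

(** * Connections with skew torsion *)

Section Connections.
Context {R : realType} {m : nat} (M : manifold R m).
Local Notation E := 'rV[R]_m.
Implicit Types (c d : chart M) (g : tensor02 M) (G L T H : tensor12 M) (f : tensor11 M).

Lemma overlap_open c d : open (overlap c d : set E).
Proof.
rewrite openE => x [cx dx].
apply: filterI; first by apply: open_nbhs_nbhs; split => //; exact: cimg_open.
apply: (par_continuous cx); apply: open_nbhs_nbhs; split => //.
exact: cdom_open.
Qed.

Lemma transition_cimg c d x : overlap c d x -> cimg M d (transition c d x).
Proof. by move=> [_ dx]; exact: crd_cimg. Qed.

Lemma transition_differentiable c d x : overlap c d x ->
  differentiable (transition c d) x.
Proof. exact: smooth_differentiable (@transition_smooth _ _ M c d). Qed.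

Lemma push_linear c d x : overlap c d x -> linear (push c d x).
Proof. by move=> cdx; apply: derive_linear; exact: transition_differentiable. Qed.

Lemma push_smooth c d v : smooth_on (overlap c d) (fun x => push c d x v).
Proof. by apply: smooth_derive; exact: transition_smooth. Qed.

(** The derivative terms cancel against the Lie bracket, which leaves the skew part of the
    Christoffel symbols. Here, in [metric_connectionP] and in [parallel11P], testing on constant
    fields turns a condition on vector fields into a pointwise one. *)
Lemma has_torsionP G T : has_torsion G T <->
  forall c x u v, cimg M c x -> G c x u v - G c x v u = T c x u v.
Proof.
have E c (X Y : E -> E) x : nabla G c X Y x - nabla G c Y X x - lie X Y x =
    G c x (X x) (Y x) - G c x (Y x) (X x).
  rewrite /nabla /lie; set a := 'D_ _ Y x; set b := 'D_ _ X x.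
  set p := G _ _ _ _; set q := G _ _ _ _.
  by apply/rowP => i; rewrite !mxE; ring.
split=> [tG c x u v cx|tG c X Y x _ _ cx]; last by rewrite E tG.
rewrite -(tG c (cst u) (cst v))// ?E//; exact: smooth_cst.
Qed.

Lemma tensor02_linearl g c x w : is_tensor02 g -> cimg M c x ->
  linear (g c x ^~ w : _ -> R^o).
Proof. by move=> [gl _ _] cx; have [_] := gl c x w cx. Qed.

Lemma tensor02_linearr g c x w : is_tensor02 g -> cimg M c x ->
  linear (g c x w : _ -> R^o).
Proof. by move=> [gl _ _] cx; have [] := gl c x w cx. Qed.

(** All bilinearity rules in one tuple, to be used as a single rewriting system before [ring] or
    [lra]. *)
Lemma tensor02_bilin g c x : is_tensor02 g -> cimg M c x ->
  ((forall u v w, g c x (u + v) w = g c x u w + g c x v w) *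
   (forall u v w, g c x (u - v) w = g c x u w - g c x v w) *
   (forall u w, g c x (- u) w = - g c x u w) *
   (forall a u w, g c x (a *: u) w = a * g c x u w) *
   (forall w, g c x 0 w = 0)) *
  ((forall u v w, g c x w (u + v) = g c x w u + g c x w v) *
   (forall u v w, g c x w (u - v) = g c x w u - g c x w v) *
   (forall u w, g c x w (- u) = - g c x w u) *
   (forall a u w, g c x w (a *: u) = a * g c x w u) *
   (forall w, g c x w 0 = 0)).
Proof.
move=> tg cx; pose l w := tensor02_linearl w tg cx; pose r w := tensor02_linearr w tg cx.
split.
  do 4?split=> *; [exact: (linear_forD (l _))|exact: (linear_forB (l _))
    |exact: (linear_forN (l _))|exact: (linear_forZ (l _))|exact: (linear_for0 (l _))].
do 4?split=> *; [exact: (linear_forD (r _))|exact: (linear_forB (r _))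
    |exact: (linear_forN (r _))|exact: (linear_forZ (r _))|exact: (linear_for0 (r _))].
Qed.

Lemma derive_tensor02 g c (Y Z : E -> E) x v : is_tensor02 g -> cimg M c x ->
  local_vf c Y -> local_vf c Z ->
  'D_v (fun y => g c y (Y y) (Z y)) x = 'D_v (fun y => g c y (Y x) (Z x)) x
    + g c x ('D_v Y x) (Z x) + g c x (Y x) ('D_v Z x).
Proof.
move=> tg cx sY sZ.
apply: (derive_bilinear_apply (W := R) (@cimg_open _ _ M c) (h := g c)) => //.
- by move=> y u cy; exact: tensor02_linearl.
- by move=> y u cy; exact: tensor02_linearr.
- by move=> u w; case: tg.
Qed.

Lemma metric_connectionP g G : is_tensor02 g -> is_connection G ->
  metric_connection g G <-> forall c x u v w, cimg M c x ->
    'D_u (fun y => g c y v w) x = g c x (G c x u v) w + g c x v (G c x u w).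
Proof.
move=> tg cG; split=> [[_ gG] c x u v w cx|gG].
  have /= := gG c (cst u) (cst v) (cst w) x.
  rewrite /nabla /= !derive_cst !add0r; apply => //; exact: smooth_cst.
split=> // c X Y Z x sX sY sZ cx.
rewrite derive_tensor02// gG// /nabla.
by rewrite !(tensor02_bilin tg cx); ring.
Qed.

Lemma app11_smooth f c (Y : E -> E) : is_tensor11 f -> local_vf c Y ->
  local_vf c (app11 f c Y).
Proof.
move=> [fl fs _] sY; apply: (linear_smooth_apply (@cimg_open _ _ M c)) => //.
by move=> x cx; exact: fl.
Qed.

Lemma nabla11E G f c (X Y : E -> E) x : is_tensor11 f -> is_connection G ->
  cimg M c x -> local_vf c Y ->
  nabla11 G f c X Y x = 'D_(X x) (fun y => f c y (Y x)) x
    + G c x (X x) (f c x (Y x)) - f c x (G c x (X x) (Y x)).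
Proof.
move=> [fl fs _] [Gl _ _] cx sY; rewrite /nabla11 /nabla /app11.
rewrite (derive_linear_apply (@cimg_open _ _ M c) (Y := Y))//; first last.
- exact: smooth_differentiable sY cx.
- by move=> y cy; exact: fl.
rewrite (linear_forD (fl c x cx)).
set p := 'D_ _ _ x; set q := f c x _; set r := G _ _ _ _; set s := f c x _.
by apply/rowP => i; rewrite !mxE; ring.
Qed.

Lemma parallel11P G f : is_tensor11 f -> is_connection G ->
  parallel11 G f <-> forall c x u v, cimg M c x ->
    'D_u (fun y => f c y v) x + G c x u (f c x v) - f c x (G c x u v) = 0.
Proof.
move=> tf cG; split=> [pf c x u v cx|pf c X Y x sX sY cx]; last first.
  by rewrite nabla11E// pf.
have := pf c (cst u) (cst v) x; rewrite nabla11E//; last exact: smooth_cst.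
by apply => //; exact: smooth_cst.
Qed.

Lemma metric_inj g c x u v : is_metric g -> cimg M c x ->
  (forall w, g c x u w = g c x v w) -> u = v.
Proof.
move=> [tg gC g0] cx uv; apply/eqP; rewrite -subr_eq0; apply/negPn/negP => /(g0 _ _ _ cx).
by rewrite !(tensor02_bilin tg cx) !uv; lra.
Qed.

(** Let [A] be the difference of the connections minus half that of the torsions, lowered by g. It
    is symmetric in its first two arguments because the torsions account for the skew parts, and
    skew in the last two because both connections are metric and both torsions are 3-forms. Such an
    [A] is zero. *)
Lemma skew_torsion_unique g G T G' T' : is_metric g ->
  metric_connection g G -> has_torsion G T -> skew_tensor12 g T ->
  metric_connection g G' -> has_torsion G' T' -> skew_tensor12 g T' ->
  forall c x u v, cimg M c x ->
    G' c x u v = G c x u v + 2^-1 *: (T' c x u v - T c x u v).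
Proof.
move=> mg gG /has_torsionP tG sT gG' /has_torsionP tG' sT' c x + + cx.
have [tg gC _] := mg.
have /(metric_connectionP tg (proj1 gG)) {}gG := gG.
have /(metric_connectionP tg (proj1 gG')) {}gG' := gG'.
pose A u v w := g c x (G' c x u v) w - g c x (G c x u v) w
  - 2^-1 * (g c x (T' c x u v) w - g c x (T c x u v) w).
have A12 u v w : A u v w = A v u w.
  have := congr1 (g c x ^~ w) (tG c x u v cx).
  have := congr1 (g c x ^~ w) (tG' c x u v cx).
  have [+ _] := sT c x u v w cx; have [+ _] := sT' c x u v w cx.
  by rewrite /A /= !(tensor02_bilin tg cx); lra.
have A23 u v w : A u v w = - A u w v.
  have := gG' c x u v w cx; rewrite gG// [g c x v _]gC// [g c x v _]gC//.
  have [_] := sT c x u v w cx; have [_] := sT' c x u v w cx.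
  by rewrite /A; lra.
(* Six alternating transpositions are the identity permutation, but they include three sign
   changes. *)
have A0 u v w : A u v w = 0.
  have : A u v w = - A u v w.
    by rewrite {1}A12 A23 A12 A23 A12 A23 !opprK.
  lra.
move=> u v; apply: (metric_inj mg cx) => w.
by have := A0 u v w; rewrite /A !(tensor02_bilin tg cx); lra.
Qed.

Lemma connection_ext G G' :
  (forall c x u v, cimg M c x -> G' c x u v = G c x u v) ->
  is_connection G -> is_connection G'.
Proof.
move=> GG [Gl Gs Gt]; split.
- move=> c x u cx; have [l1 l2] := Gl c x u cx.
  split=> a v w; rewrite !GG//; [exact: l1|exact: l2].
- move=> c u v; apply: smooth_ext (Gs c u v); first exact: cimg_open.
  by move=> x cx; rewrite GG.
- move=> c d x u v cdx; have [cx _] := cdx.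
  by rewrite !GG//; [exact: Gt|exact: transition_cimg].
Qed.

Lemma connection_add G H : is_connection G -> is_tensor12 H ->
  is_connection (fun c x u v => G c x u v + H c x u v).
Proof.
move=> [Gl Gs Gt] [Hl Hs Ht]; split.
- move=> c x u cx; have [l1 l2] := Gl c x u cx; have [h1 h2] := Hl c x u cx.
  split=> a v w /=; first by rewrite l1 h1 scalerDr addrACA.
  by rewrite l2 h2 scalerDr addrACA.
- by move=> c u v; apply: smoothD => //; exact: cimg_open.
- move=> c d x u v cdx; rewrite Gt// Ht// (linear_forD (push_linear cdx)).
  by rewrite -!addrA [- _ + _]addrC.
Qed.

Lemma tensor12D T H : is_tensor12 T -> is_tensor12 H ->
  is_tensor12 (fun c x u v => T c x u v + H c x u v).
Proof.
move=> [Gl Gs Gt] [Hl Hs Ht]; split.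
- move=> c x u cx; have [l1 l2] := Gl c x u cx; have [h1 h2] := Hl c x u cx.
  by split=> k v w /=; rewrite (l1, l2) (h1, h2) scalerDr addrACA.
- by move=> c u v; apply: smoothD => //; exact: cimg_open.
- by move=> c d x u v cdx; rewrite Gt// Ht// (linear_forD (push_linear cdx)).
Qed.

Lemma tensor12Z a T : is_tensor12 T -> is_tensor12 (fun c x u v => a *: T c x u v).
Proof.
move=> [Tl Ts Tt]; split.
- move=> c x u cx; have [l1 l2] := Tl c x u cx.
  by split=> k v w /=; rewrite (l1, l2) scalerDr !scalerA mulrC.
- by move=> c u v; apply: smoothZ => //; exact: cimg_open.
- by move=> c d x u v cdx; rewrite Tt// (linear_forZ (push_linear cdx)).
Qed.

Lemma skew_tensor12D g T H : is_tensor02 g ->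
  skew_tensor12 g T -> skew_tensor12 g H ->
  skew_tensor12 g (fun c x u v => T c x u v + H c x u v).
Proof.
move=> tg sT sH c x u v w cx; have [T1 T2] := sT c x u v w cx.
have [H1 H2] := sH c x u v w cx.
by rewrite !(tensor02_bilin tg cx); split; [rewrite T1 H1|rewrite T2 H2]; ring.
Qed.

Lemma skew_tensor12Z g a T : is_tensor02 g -> skew_tensor12 g T ->
  skew_tensor12 g (fun c x u v => a *: T c x u v).
Proof.
move=> tg sT c x u v w cx; have [T1 T2] := sT c x u v w cx.
by rewrite !(tensor02_bilin tg cx); split; [rewrite T1|rewrite T2]; ring.
Qed.

(** Half of a 3-form is skew in the last two slots, so metricity survives; antisymmetrizing it in
    the first two slots doubles it, so the torsion grows by all of [H]. *)
Lemma skew_torsion_connection_add g G T H : is_metric g ->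
  skew_torsion_connection g G T -> is_tensor12 H -> skew_tensor12 g H ->
  skew_torsion_connection g (fun c x u v => G c x u v + 2^-1 *: H c x u v)
    (fun c x u v => T c x u v + H c x u v).
Proof.
move=> mg [gG tT /has_torsionP GT sT] tH sH; have [tg gC _] := mg.
have cG := proj1 gG; have cGH := connection_add cG (tensor12Z 2^-1 tH).
have /(metric_connectionP tg cG) {}gG := gG.
split.
- apply/(metric_connectionP tg cGH) => c x u v w cx.
  have [_] := sH c x u v w cx; rewrite gG// !(tensor02_bilin tg cx).
  rewrite [g c x v (H _ _ _ _)]gC//; lra.
- exact: tensor12D.
- apply/has_torsionP => c x u v cx; rewrite -GT//.
  have [HC _] : (forall w, g c x (H c x u v) w = - g c x (H c x v u) w) /\ True.
    by split=> // w; have [] := sH c x u v w cx.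
  by apply: (metric_inj mg cx) => w; rewrite !(tensor02_bilin tg cx) HC; lra.
- exact: skew_tensor12D.
Qed.

Lemma skew_torsion_connection_ext g G G' T : is_metric g ->
  (forall c x u v, cimg M c x -> G' c x u v = G c x u v) ->
  skew_torsion_connection g G T -> skew_torsion_connection g G' T.
Proof.
move=> [tg _ _] GG [gG tT /has_torsionP GT sT].
have cG' := connection_ext GG (proj1 gG); split=> //.
  apply/(metric_connectionP tg cG') => c x u v w cx; rewrite !GG//.
  exact: (metric_connectionP tg (proj1 gG)).1.
by apply/has_torsionP => c x u v cx; rewrite !GG// GT.
Qed.

Lemma tensor12_0 : is_tensor12 ((fun _ _ _ _ => 0) : tensor12 M).
Proof.
split=> [c x u cx|c u v|c d x u v cdx]; last by rewrite (linear_for0 (push_linear cdx)).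
  by split=> a v w; rewrite scaler0 addr0.
exact: smooth_cst.
Qed.

(** Makes the results on skew torsion available for the Levi-Civita connection, as the case of
    torsion zero. *)
Lemma levi_civita_skew_torsion g L : is_tensor02 g -> levi_civita g L <->
  skew_torsion_connection g L (fun _ _ _ _ => 0).
Proof.
move=> tg; split=> [[gL L0]|[gL _ L0 _]//]; split=> //; first exact: tensor12_0.
by move=> c x u v w cx; rewrite !(tensor02_bilin tg cx) oppr0.
Qed.

End Connections.

(** * The cone and its appendant connections *)

Section ConeCalculus.
Context {R : realType} {m : nat} (M : manifold R m).
Local Notation E := 'rV[R]_m.
Local Notation E1 := 'rV[R]_(m + 1).
Implicit Types (c d : chart M).

Fact mpart_linear : linear (@mpart R m).
Proof. by move=> a u v; rewrite /mpart linearP. Qed.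
HB.instance Definition _ := GRing.isLinear.Build R E1 E *:%R (@mpart R m)
  mpart_linear.

Fact rpart_linear : linear (@rpart R m : _ -> R^o).
Proof. by move=> a u v; rewrite /rpart linearP !mxE. Qed.
HB.instance Definition _ := GRing.isLinear.Build R E1 R^o *:%R (@rpart R m)
  rpart_linear.

Definition cpair (u : E) (s : R) : E1 := row_mx u (const_mx s).

Lemma mpart_cpair u s : mpart (cpair u s) = u.
Proof. exact: mpart_row_mx. Qed.

Lemma rpart_cpair u s : rpart (cpair u s) = s.
Proof. by rewrite rpart_row_mx mxE. Qed.

Lemma cone_vector_ext (y z : E1) : mpart y = mpart z -> rpart y = rpart z -> y = z.
Proof. by move=> yz1 yz2; rewrite -(row_mpart_rpart y) yz1 yz2 row_mpart_rpart. Qed.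

Lemma mpart_rpartE :
  ((forall u v : E1, mpart (u + v) = mpart u + mpart v) *
   (forall u v : E1, mpart (u - v) = mpart u - mpart v) *
   (forall u : E1, mpart (- u) = - mpart u) *
   (forall k (u : E1), mpart (k *: u) = k *: mpart u) * (mpart (0 : E1) = 0)) *
  ((forall u v : E1, rpart (u + v) = rpart u + rpart v) *
   (forall u v : E1, rpart (u - v) = rpart u - rpart v) *
   (forall u : E1, rpart (- u) = - rpart u) *
   (forall k (u : E1), rpart (k *: u) = k * rpart u) * (rpart (0 : E1) = 0)) *
  (forall u s, mpart (cpair u s) = u) * (forall u s, rpart (cpair u s) = s).
Proof.
do 3?split; try exact: mpart_cpair; try exact: rpart_cpair;
  do 4?split=> *; by rewrite ?(linearD, linearB, linearN, linearZ, linear0).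
Qed.

Lemma cpairE u s : cpair u s = rowl u + s *: rowr (const_mx 1).
Proof.
rewrite /cpair -rowlr; congr (_ + _); rewrite -linearZ /=; congr rowr.
by apply/matrixP => i j; rewrite !mxE mulr1.
Qed.

Lemma cone_cimgP c (y : E1) : cimg (cone M) c y -> cimg M c (mpart y) /\ 0 < rpart y.
Proof. by []. Qed.

Section Smooth.
Context {W : normedModType R}.

Lemma smooth_mpart c (f : E -> W) : smooth_on (cimg M c) f ->
  smooth_on (cimg (cone M) c) (fun y => f (mpart y)).
Proof.
move=> sf k; apply: (@Ck_on_subset _ _ _ _ _ _ _ (fun y cy => (cone_cimgP cy).1)).
exact: (@Ck_on_comp_linear _ _ _ _ _ _ _ (@mpart R m) (@cimg_open _ _ M c)
  (@continuous_mpart R m) (sf k)).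
Qed.

Lemma derive_mpart (f : E -> W) (y w : E1) : differentiable f (mpart y) ->
  'D_w (fun y => f (mpart y)) y = 'D_(mpart w) f (mpart y).
Proof. exact: (derive_comp_linear (L := @mpart R m) w (@continuous_mpart R m)). Qed.
End Smooth.

Lemma smooth_rpart c : smooth_on (cimg (cone M) c) (@rpart R m).
Proof. by move=> k; exact: (@Ck_on_linear _ _ _ _ _ (@rpart R m) (@continuous_rpart R m)). Qed.

Lemma differentiable_rpart (y : E1) : differentiable (@rpart R m) y.
Proof. exact: (@linear_differentiable _ _ _ (@rpart R m) _ (@continuous_rpart R m)). Qed.

Lemma derive_rpart (y w : E1) : 'D_w (@rpart R m) y = rpart w.
Proof.
rewrite deriveE; last exact: differentiable_rpart.
by rewrite (diff_lin _ (@continuous_rpart R m)).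
Qed.

Lemma smooth_rpart_inv c : smooth_on (cimg (cone M) c) (fun y => (rpart y)^-1).
Proof.
apply: smooth_inv; [exact: cimg_open| |exact: smooth_rpart].
by move=> y [_ y0]; rewrite gt_eqF.
Qed.

Lemma smooth_cpair c (f : E1 -> E) (h : E1 -> R) :
  smooth_on (cimg (cone M) c) f -> smooth_on (cimg (cone M) c) h ->
  smooth_on (cimg (cone M) c) (fun y => cpair (f y) (h y)).
Proof.
move=> sf sh; have oU := @cimg_open _ _ (cone M) c.
apply: (smooth_ext oU (f := fun y => rowl (f y) + h y *: rowr (const_mx 1))).
  by move=> y _; rewrite cpairE.
apply: (smoothD oU); last by apply: (smooth_scale oU) => //; exact: smooth_cst.
by apply: (smooth_linear_comp oU) => //; exact: continuous_rowl.
Qed.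

Lemma differentiable_cpair (f : E1 -> E) (h : E1 -> R) (y : E1) :
  differentiable f y -> differentiable h y ->
  differentiable (fun y => cpair (f y) (h y)) y.
Proof.
move=> df dh.
have -> : (fun y => cpair (f y) (h y)) =
    (fun y => rowl (f y)) + (fun y => h y *: rowr (const_mx 1)).
  by apply/funext => z; rewrite cpairE.
apply: differentiableD; last first.
  by apply: differentiable_scale => //; exact: differentiable_cst.
apply: (differentiable_comp df); apply: linear_differentiable.
exact: continuous_rowl.
Qed.

Lemma derive_cpair (f : E1 -> E) (h : E1 -> R) (y w : E1) :
  differentiable f y -> differentiable h y ->
  'D_w (fun y => cpair (f y) (h y)) y = cpair ('D_w f y) ('D_w h y).
Proof.
move=> df dh; rewrite cpairE.
have -> : (fun y => cpair (f y) (h y)) =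
    (fun y => rowl (f y)) + (fun y => h y *: rowr (const_mx 1)).
  by apply/funext => z; rewrite cpairE.
have dl : differentiable (fun y => rowl (f y) : E1) y.
  apply: (differentiable_comp df); apply: linear_differentiable.
  exact: continuous_rowl.
rewrite deriveD; [|exact: diff_derivable|]; last first.
  by apply/diff_derivable/differentiable_scale => //; exact: differentiable_cst.
rewrite (derive_linear_comp (B := @rowl R m 1))//; last exact: continuous_rowl.
have dc : differentiable (cst (rowr (const_mx 1) : E1)) y by exact: differentiable_cst.
by rewrite derive_scale// derive_cst scaler0 add0r.
Qed.

Lemma cone_overlap c d (y : E1) : overlap (M := cone M) c d y ->
  overlap (M := M) c d (mpart y) /\ 0 < rpart y.
Proof. by move=> [[cy y0] dy]; split. Qed.

Lemma cone_transition c d (y : E1) : overlap (M := cone M) c d y ->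
  transition (M := cone M) c d y = cpair (transition (M := M) c d (mpart y)) (rpart y).
Proof. by move=> [[_ y0] _]; rewrite /transition /= /cone_crd /= val_to_posR. Qed.

Lemma cone_push c d (y w : E1) : overlap (M := cone M) c d y ->
  push (M := cone M) c d y w = cpair (push (M := M) c d (mpart y) (mpart w)) (rpart w).
Proof.
move=> cdy; have [cdx _] := cone_overlap cdy.
rewrite /push (derive_ext w (@overlap_open _ _ (cone M) c d) cdy
  (g := fun y => cpair (transition (M := M) c d (mpart y)) (rpart y))); last first.
  by move=> z; exact: cone_transition.
have dt := transition_differentiable cdx.
rewrite derive_cpair ?derive_mpart ?derive_rpart//.
  apply: (differentiable_comp (f := @mpart R m) (g := transition (M := M) c d)) => //.
  by apply: linear_differentiable; exact: continuous_mpart.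
exact: differentiable_rpart.
Qed.

Lemma cone_derive_push c d (y u w : E1) : overlap (M := cone M) c d y ->
  'D_u (fun y => push (M := cone M) c d y w) y =
  cpair ('D_(mpart u) (fun x => push (M := M) c d x (mpart w)) (mpart y)) 0.
Proof.
move=> cdy; have [cdx _] := cone_overlap cdy.
rewrite (derive_ext u (@overlap_open _ _ (cone M) c d) cdy
  (g := fun y => cpair (push (M := M) c d (mpart y) (mpart w)) (rpart w))); last first.
  by move=> z; exact: cone_push.
have dp : differentiable (fun x => push (M := M) c d x (mpart w)) (mpart y).
  exact: smooth_differentiable (push_smooth _ _ _) cdx.
rewrite derive_cpair//; last first.
  apply: (differentiable_comp (f := @mpart R m)
    (g := fun x => push (M := M) c d x (mpart w))) => //.
  by apply: linear_differentiable; exact: continuous_mpart.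
by have := derive_mpart u dp; have := derive_cst (rpart w) y u; move=> -> ->.
Qed.

End ConeCalculus.

Section ConeConnection.
Context {R : realType} {m : nat} (M : manifold R m) (a : R) (g : tensor02 M).
Hypotheses (a0 : a != 0) (mg : is_metric g).
Local Notation E := 'rV[R]_m.
Local Notation E1 := 'rV[R]_(m + 1).
Local Notation h := (cone_metric a g).
Implicit Types (c d : chart M) (L T : tensor12 M).

Let tg : is_tensor02 g. Proof. by case: mg. Qed.

Lemma cone_smooth_g c u v : smooth_on (cimg (cone M) c)
  (fun y : E1 => g c (mpart y) u v).
Proof. by apply: (smooth_mpart (f := fun x => g c x u v)); case: tg. Qed.

Lemma cone_metric_is_metric : is_metric h.
Proof.
have oU c := @cimg_open _ _ (cone M) c.
have [_ gC g0] := mg; split.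
- split.
  + move=> c y u [cy y0]; split=> k v w.
      by rewrite /cone_metric !mpart_rpartE !(tensor02_bilin tg cy); ring.
    by rewrite /cone_metric !mpart_rpartE !(tensor02_bilin tg cy); ring.
  + move=> c u v; apply: (smoothD (W := R) (oU c)); last exact: smooth_cst.
    apply: (smoothM (oU c)); last exact: cone_smooth_g.
    apply: (smoothM (oU c)); first exact: smooth_cst.
    have sr := @smooth_rpart _ _ M c.
    by apply: (smooth_ext (oU c)) (smoothM (oU c) sr sr) => y _; rewrite expr2.
  + move=> c d y u v cdy; have [cdx _] := cone_overlap cdy.
    rewrite /cone_metric (cone_transition cdy) !(cone_push _ cdy).
    rewrite !mpart_rpartE.
    by have [_ _ ->] := tg.
- by move=> c y u v [cy y0]; rewrite /cone_metric gC// [rpart u * _]mulrC.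
- move=> c y u [cy y0] u0; rewrite /cone_metric.
  have ar0 : 0 < a ^+ 2 * rpart y ^+ 2.
    by rewrite -exprMn exprn_even_gt0//= mulf_neq0// gt_eqF.
  have [mu0|mu0] := eqVneq (mpart u) 0.
    rewrite mu0 (tensor02_bilin tg cy) mulr0 add0r -expr2 exprn_even_gt0//=.
    apply: contra_neq u0 => ru0; apply: cone_vector_ext; first by rewrite mu0 mpart_rpartE.
    by rewrite ru0 mpart_rpartE.
  by rewrite ltr_pwDl//; [rewrite mulr_gt0 ?g0|rewrite -expr2 sqr_ge0].
Qed.

Lemma cone_lift_tensor12 T : is_tensor12 T -> is_tensor12 (cone_lift T).
Proof.
move=> [Tl Ts Tt].
have liftE c (y u v : E1) : cone_lift T c y u v = cpair (T c (mpart y) (mpart u) (mpart v)) 0.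
  by rewrite /cone_lift /cpair; congr row_mx; apply/matrixP => i j; rewrite !mxE.
split.
- move=> c y u [cy y0]; have [l1 l2] := Tl c _ (mpart u) cy.
  split=> k v w; apply: cone_vector_ext; rewrite !liftE !mpart_rpartE.
  + by rewrite l1.
  + by rewrite mulr0 addr0.
  + by rewrite l2.
  + by rewrite mulr0 addr0.
- move=> c u v; apply: (smooth_ext (@cimg_open _ _ (cone M) c)
    (f := fun y : E1 => cpair (T c (mpart y) (mpart u) (mpart v)) 0)).
    by move=> y _; rewrite liftE.
  by apply: smooth_cpair; [apply: (smooth_mpart (f := fun x => T c x _ _))|exact: smooth_cst].
- move=> c d y u v cdy; have [cdx _] := cone_overlap cdy.
  rewrite !liftE (cone_transition cdy) !(cone_push _ cdy).
  by rewrite !mpart_rpartE Tt.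
Qed.

Lemma cone_lift_skew T : skew_tensor12 g T -> skew_tensor12 h (cone_lift T).
Proof.
move=> sT c y u v w [cy y0]; have [T1 T2] := sT c _ (mpart u) (mpart v) (mpart w) cy.
rewrite /cone_metric /cone_lift !mpart_row_mx !rpart_row_mx !mxE.
by split; [rewrite T1|rewrite T2]; ring.
Qed.

(** The warped product formulas: for X, Y tangent to M the derivative of Y along X gains the radial
    term -a^2 r g(X,Y), and the mixed derivatives of X and d/dr are X/r. [L] may be any connection
    on M, also one with torsion. *)
Definition cone_connection L : tensor12 (cone M) := fun c (y v w : E1) =>
  cpair (L c (mpart y) (mpart v) (mpart w)
         + (rpart y)^-1 *: (rpart v *: mpart w + rpart w *: mpart v))
        (- (a ^+ 2 * rpart y * g c (mpart y) (mpart v) (mpart w))).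

Lemma cone_connection_is_connection L : is_connection L ->
  is_connection (cone_connection L).
Proof.
move=> [Ll Ls Lt]; have oU c := @cimg_open _ _ (cone M) c; split.
- move=> c y u [cy y0]; have [l1 l2] := Ll c _ (mpart u) cy.
  split=> k v w; apply: cone_vector_ext; rewrite /cone_connection !mpart_rpartE.
  + rewrite l1; apply/rowP => i; rewrite !mxE; ring.
  + rewrite !(tensor02_bilin tg cy); ring.
  + rewrite l2; apply/rowP => i; rewrite !mxE; ring.
  + rewrite !(tensor02_bilin tg cy); ring.
- move=> c u v; apply: smooth_cpair.
    apply: smoothD => //; first by apply: (smooth_mpart (f := fun x => L c x _ _)).
    by apply: smooth_scale => //; [exact: smooth_rpart_inv|exact: smooth_cst].
  apply: (smoothN (W := R) (oU c)); apply: (smoothM (oU c)); last exact: cone_smooth_g.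
  by apply: (smoothM (oU c)); [exact: smooth_cst|exact: smooth_rpart].
- move=> c d y u v cdy; have [cdx _] := cone_overlap cdy.
  have pl := push_linear cdx.
  rewrite (cone_derive_push _ _ cdy) /cone_connection (cone_transition cdy).
  rewrite !(cone_push _ cdy) !mpart_rpartE Lt//.
  have [_ _ ->//] := tg.
  rewrite !(linear_forD pl) !(linear_forZ pl) !(linear_forD pl) !(linear_forZ pl).
  apply: cone_vector_ext; rewrite !mpart_rpartE ?subr0//.
  by rewrite addrAC.
Qed.

(** The terms added to [L] are symmetric, so no torsion arises. For metricity, the X/r terms account
    for the derivative of r^2, and the radial term compensates the mixed ones. *)
Lemma cone_levi_civita L : levi_civita g L -> levi_civita h (cone_connection L).
Proof.
move=> [gL /has_torsionP L0].
have cL := cone_connection_is_connection (proj1 gL).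
have [th hC _] := cone_metric_is_metric; have [_ gC _] := mg.
split; last first.
  apply/has_torsionP => c y u v [cy y0]; apply: cone_vector_ext.
    rewrite !mpart_rpartE opprD addrACA L0// add0r.
    by rewrite [rpart v *: _ + _]addrC subrr.
  by rewrite !mpart_rpartE gC// subrr.
apply/(metric_connectionP th cL) => c y u v w [cy y0].
have /(metric_connectionP tg (proj1 gL))/(_ c _ (mpart u) (mpart v) (mpart w) cy) {}gL := gL.
have dr := differentiable_rpart y.
have dg : differentiable (fun x => g c x (mpart v) (mpart w)) (mpart y).
  by apply: (smooth_differentiable _ cy); case: tg.
have dgm : differentiable (fun y : E1 => g c (mpart y) (mpart v) (mpart w)) y.
  apply: (differentiable_comp (f := @mpart R m) (g := fun x => g c x (mpart v) (mpart w))) => //.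
  by apply: linear_differentiable; exact: continuous_mpart.
have -> : 'D_u (fun y => h c y v w) y =
    a ^+ 2 * ((rpart u * rpart y + rpart y * rpart u) * g c (mpart y) (mpart v) (mpart w)
     + rpart y ^+ 2 * 'D_(mpart u) (fun x => g c x (mpart v) (mpart w)) (mpart y)).
  have -> : (fun y => h c y v w) =
      (fun y => a ^+ 2 *: (rpart y *: (rpart y *: g c (mpart y) (mpart v) (mpart w)) : R))
      + cst (rpart v * rpart w).
    by apply/funext => z; rewrite /cone_metric !fctE /= /GRing.scale /= expr2 !mulrA.
  have drg := differentiable_scale (W := R) dr dgm.
  have drrg := differentiable_scale (W := R) dr drg.
  rewrite deriveD; [|by apply/diff_derivable/differentiableZ|exact: derivable_cst].
  rewrite derive_cst addr0 deriveZ; last exact: diff_derivable.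
  rewrite (derive_scale (W := R) u dr drg) (derive_scale (W := R) u dr dgm) derive_rpart.
  rewrite (derive_mpart (f := fun x => g c x (mpart v) (mpart w)) u dg).
  set p := 'D_ _ _ _; rewrite /GRing.scale /=; move: p => p.
  by ring.
rewrite gL /cone_connection /cone_metric !mpart_rpartE.
rewrite !(tensor02_bilin tg cy).
rewrite [g c _ (mpart v) (mpart u)]gC//.
move: (g c _ _ (mpart w)) (g c _ _ (mpart w)) => ? ?.
by field; rewrite gt_eqF.
Qed.

(** The warped extension is affine in the connection. Adding half the lifted torsion upstairs is
    therefore the same as adding half the torsion on M first. *)
Lemma cone_connection_add G T c (y v w : E1) :
  cone_connection G c y v w + 2^-1 *: cone_lift T c y v w =
  cone_connection (fun c x u v => G c x u v + 2^-1 *: T c x u v) c y v w.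
Proof.
apply: cone_vector_ext; rewrite /cone_lift !mpart_rpartE.
  by rewrite addrAC.
by rewrite mulr0 addr0.
Qed.

Lemma torsion_free_part G T : skew_torsion_connection g G T ->
  levi_civita g (fun c x u v => G c x u v - 2^-1 *: T c x u v).
Proof.
move=> gG; have [_ tT _ sT] := gG; apply/(levi_civita_skew_torsion _ tg).
have := skew_torsion_connection_add mg gG (tensor12Z (-1) tT) (skew_tensor12Z (-1) tg sT).
have -> : (fun c x u v => G c x u v + 2^-1 *: (-1 *: T c x u v)) =
    (fun c x u v => G c x u v - 2^-1 *: T c x u v).
  by apply/funext => c; do 3!apply/funext => ?; rewrite scaleN1r scalerN.
congr skew_torsion_connection.
by apply/funext => c; do 3!apply/funext => ?; rewrite scaleN1r subrr.
Qed.

Lemma appendant_exists G T : skew_torsion_connection g G T ->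
  exists D, appendant a g T D.
Proof.
move=> /torsion_free_part/cone_levi_civita gL.
by eexists; exists (cone_connection (fun c x u v => G c x u v - 2^-1 *: T c x u v)).
Qed.

(** The Levi-Civita connection inside [appendant] is the explicit one by uniqueness. Adding half the
    torsion on M restores [G], so the appendant connection is the warped extension of [G]. *)
Lemma appendantE G T D : skew_torsion_connection g G T -> appendant a g T D ->
  forall c y v w, cimg (cone M) c y -> D c y v w = cone_connection G c y v w.
Proof.
move=> gG [L [hL L0] DL] c y v w cy.
have [hL' L'0] := cone_levi_civita (torsion_free_part gG).
have [th _ _] := cone_metric_is_metric.
have s0 : skew_tensor12 h (fun _ _ _ _ => 0).
  by move=> c' y' u' v' w' cy'; rewrite !(tensor02_bilin th cy') oppr0.
rewrite DL// (skew_torsion_unique cone_metric_is_metric hL' L'0 s0 hL L0 s0 _ _ cy).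
rewrite subrr scaler0 addr0 cone_connection_add /cone_connection.
by rewrite subrK.
Qed.

Lemma appendant_skew_torsion G T D : skew_torsion_connection g G T ->
  appendant a g T D -> skew_torsion_connection h D (cone_lift T).
Proof.
move=> [_ tT _ sT] [L /(levi_civita_skew_torsion _ (let: And3 t _ _ := cone_metric_is_metric in t)) hL DL].
apply: (skew_torsion_connection_ext cone_metric_is_metric DL).
have := skew_torsion_connection_add cone_metric_is_metric hL
  (cone_lift_tensor12 tT) (cone_lift_skew sT).
congr skew_torsion_connection.
by apply/funext => c; do 3!apply/funext => ?; rewrite add0r.
Qed.

End ConeConnection.

(** * Almost 3-contact metric structures *)

Lemma even_perm3_cases (i j k : 'I_3) : even_perm3 i j k ->
  [\/ [/\ i = 0, j = 1 & k = 2%:R], [/\ i = 1, j = 2%:R & k = 0]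
    | [/\ i = 2%:R, j = 0 & k = 1]].
Proof.
rewrite /even_perm3 !inE => /or3P[] /eqP[i_ j_ k_]; [constructor 1|constructor 2|constructor 3];
  by split; apply: val_inj.
Qed.

Lemma even_perm3_rot i j k : even_perm3 i j k -> even_perm3 j k i.
Proof. by move=> /even_perm3_cases[] [-> -> ->]. Qed.

Lemma even_perm3_ex (i : 'I_3) : exists j k, even_perm3 i j k.
Proof.
case: i => -[|[|[|//]]] i3.
- by exists 1, 2%:R.
- by exists 2%:R, 0.
- by exists 0, 1.
Qed.

(** Lets a sum over the three indices start at any given i, so that one computation serves all three
    structures. *)
Lemma sum_even_perm3 (V : nmodType) (F : 'I_3 -> V) i j k : even_perm3 i j k ->
  \sum_(l < 3) F l = F i + F j + F k.
Proof.
have -> : \sum_(l < 3) F l = F 0 + F 1 + F 2%:R.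
  rewrite !big_ord_recl big_ord0 addr0 addrA.
  by do 2?congr (_ + _); congr F; apply: val_inj.
move=> /even_perm3_cases[] [-> -> ->] //; first by rewrite -addrA addrC.
by rewrite addrC addrA.
Qed.

Section Contact3Algebra.
Context {R : realType} {m : nat} {M : manifold R m} {S : contact3 M}.
Hypothesis hS : almost_3contact_metric S.
Local Notation E := 'rV[R]_m.
Local Notation g := (ac_g S).
Local Notation phi := (ac_phi S).
Local Notation xi := (ac_xi S).
Local Notation eta := (ac_eta S).

Lemma ac_metric : is_metric g.
Proof. by have [[]] := hS.1 0. Qed.

Lemma ac_phi_tensor i : is_tensor11 (phi i).
Proof. by have [[]] := hS.1 i. Qed.

Lemma ac_xi_vfield i : is_vfield (xi i).
Proof. by have [[]] := hS.1 i. Qed.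

Lemma ac_eta_oneform i : is_oneform (eta i).
Proof. by have [[]] := hS.1 i. Qed.

Section Point.
Context {c : chart M} {x : E} (cx : cimg M c x).
Local Notation G := (g c x).
Local Notation p i := (phi i c x).
Local Notation z i := (xi i c x).
Local Notation e i := (eta i c x).

Let tg : is_tensor02 g. Proof. by case: ac_metric. Qed.

Lemma ac_gC u v : G u v = G v u.
Proof. by case: ac_metric => _ + _; exact. Qed.

Lemma ac_linear :
  ((forall i u v, p i (u + v) = p i u + p i v) *
   (forall i u v, p i (u - v) = p i u - p i v) *
   (forall i u, p i (- u) = - p i u) *
   (forall i a u, p i (a *: u) = a *: p i u) *
   (forall i, p i 0 = 0)) *
  ((forall i u v, e i (u + v) = e i u + e i v) *
   (forall i u v, e i (u - v) = e i u - e i v) *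
   (forall i u, e i (- u) = - e i u) *
   (forall i a u, e i (a *: u) = a * e i u) *
   (forall i, e i 0 = 0)).
Proof.
have lp i : linear (p i) by case: (ac_phi_tensor i) => + _ _; exact.
have le i : scalar (e i) by case: (ac_eta_oneform i) => + _ _; exact.
split.
  do 4?split=> *; [exact: (linear_forD (lp _))|exact: (linear_forB (lp _))
    |exact: (linear_forN (lp _))|exact: (linear_forZ (lp _))|exact: (linear_for0 (lp _))].
do 4?split=> *; [exact: (linear_forD (le _))|exact: (linear_forB (le _))
    |exact: (linear_forN (le _))|exact: (linear_forZ (le _))|exact: (linear_for0 (le _))].
Qed.

Lemma ac_phi2 i u : p i (p i u) = - u + e i u *: z i.
Proof. by case: (hS.1 i) => _ + _ _; exact. Qed.

Lemma ac_eta_xi i : e i (z i) = 1.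
Proof. by case: (hS.1 i) => _ _ + _; exact. Qed.

(** From phi^2 xi = 0 and the formula for phi^2 at phi xi one gets phi xi = eta(phi xi) xi. Applying
    phi again gives eta(phi xi) phi xi = 0, and either factor being zero suffices. *)
Lemma ac_phi_xi i : p i (z i) = 0.
Proof.
have h : p i (p i (z i)) = 0 by rewrite ac_phi2 ac_eta_xi scale1r addNr.
have := ac_phi2 i (p i (z i)); rewrite h ac_linear => /esym/eqP.
rewrite addrC subr_eq0 => /eqP he.
have := congr1 (p i) he; rewrite ac_linear h => /eqP.
by rewrite scaler_eq0 => /orP[/eqP e0|/eqP //]; rewrite -he e0 scale0r.
Qed.

Lemma ac_xi_neq0 i : z i != 0.
Proof.
apply/eqP => z0; have := ac_eta_xi i; rewrite z0 ac_linear => /eqP.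
by rewrite eq_sym oner_eq0.
Qed.

(** Compute phi^3 u in two ways, as phi^2 of phi u and as phi of phi^2 u; the results differ by
    eta(phi u) xi. *)
Lemma ac_eta_phi i u : e i (p i u) = 0.
Proof.
have := ac_phi2 i (p i u).
rewrite [p i (p i u)]ac_phi2 !ac_linear ac_phi_xi scaler0 addr0 => /esym/eqP.
rewrite -subr_eq0 opprK addrAC addNr add0r scaler_eq0 (negPf (ac_xi_neq0 i)) orbF.
by move/eqP.
Qed.

Lemma ac_g_phi_phi i u v : G (p i u) (p i v) = G u v - e i u * e i v.
Proof. by case: (hS.1 i) => _ _ _; exact. Qed.

Lemma ac_g_xi i u : G u (z i) = e i u.
Proof.
have := ac_g_phi_phi i u (z i).
by rewrite ac_phi_xi (tensor02_bilin tg cx) ac_eta_xi mulr1; lra.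
Qed.

Lemma ac_g_phi i u v : G (p i u) v = - G u (p i v).
Proof.
have := ac_g_phi_phi i u (p i v).
by rewrite ac_phi2 ac_eta_phi !(tensor02_bilin tg cx) ac_g_xi ac_eta_phi; lra.
Qed.

Lemma ac_g_ext u v : (forall w, G u w = G v w) -> u = v.
Proof. exact: metric_inj ac_metric cx. Qed.

Lemma ac_rules1 :
  (forall i u, p i (p i u) = - u + e i u *: z i) * (forall i, p i (z i) = 0) *
  (forall i, e i (z i) = 1) * (forall i u, e i (p i u) = 0) *
  (forall i u v, G (p i u) v = - G u (p i v)) *
  (forall i u, G u (z i) = e i u) * (forall i u, G (z i) u = e i u).
Proof.
do 6?split=> *; [exact: ac_phi2|exact: ac_phi_xi|exact: ac_eta_xi
  |exact: ac_eta_phi|exact: ac_g_phi|exact: ac_g_xi|by rewrite ac_gC ac_g_xi].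
Qed.

Lemma ac_rules2 i j k : even_perm3 i j k ->
  (forall u, p i (p j u) = p k u + e j u *: z i) *
  (forall u, p j (p i u) = - p k u + e i u *: z j) *
  (p i (z j) = z k) * (p j (z i) = - z k) *
  (forall u, e i (p j u) = e k u) * (forall u, e j (p i u) = - e k u) *
  (e i (z j) = 0) * (e j (z i) = 0).
Proof.
move=> ijk; have [pp [zz1 zz2] ee] := hS.2 i j k ijk c x cx.
(* The permutation (k, i, j) gives xi_j = - phi_i xi_k, and eta_i vanishes on the image of phi_i. *)
have eij : e i (z j) = 0.
  have [_ [_ ->] _] := hS.2 _ _ _ (even_perm3_rot (even_perm3_rot ijk)) c x cx.
  by rewrite ac_linear ac_eta_phi oppr0.
split; [do 6?split=> //|].
- by move=> u; have [-> _] := pp u; rewrite subrK.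
- by move=> u; have [_ ->] := pp u; rewrite opprD opprK subrK.
- by rewrite zz2 opprK.
- by move=> u; have [-> _] := ee u.
- by move=> u; have [_ ->] := ee u; rewrite opprK.
- by rewrite -ac_g_xi ac_gC ac_g_xi.
Qed.

(** One rewriting system for all three cyclic rotations of (i, j, k): it removes compositions of the
    phi's and evaluates the eta's, so tensor identities tested against a vector become polynomial
    ones for [ring]. *)
Definition ac_rules i j k (ijk : even_perm3 i j k) :=
  (ac_linear, tensor02_bilin tg cx, ac_rules1, ac_rules2 ijk,
   ac_rules2 (even_perm3_rot ijk), ac_rules2 (even_perm3_rot (even_perm3_rot ijk))).

End Point.
End Contact3Algebra.

(** * The vector-valued forms [Theta] and [Omega] *)

Section Theta.
Context {R : realType} {m : nat} {M : manifold R m} (S : contact3 M).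
Hypothesis hS : almost_3contact_metric S.
Local Notation E := 'rV[R]_m.
Local Notation g := (ac_g S).
Local Notation phi := (ac_phi S).
Local Notation xi := (ac_xi S).
Local Notation eta := (ac_eta S).

(* The vector-valued 2-form of the 3-form
   [eta_1 /\ Phi_1 + eta_2 /\ Phi_2 + eta_3 /\ Phi_3]. *)
Definition Theta : tensor12 M := fun c x u v =>
  \sum_(l < 3) (eta l c x v *: phi l c x u - eta l c x u *: phi l c x v
                + g c x u (phi l c x v) *: xi l c x).

Lemma ThetaE i j k c x u v : even_perm3 i j k ->
  let F l := eta l c x v *: phi l c x u - eta l c x u *: phi l c x v
                + g c x u (phi l c x v) *: xi l c x in
  Theta c x u v = F i + F j + F k.
Proof. exact: sum_even_perm3. Qed.

Lemma g_Theta c x u v w : cimg M c x ->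
  g c x (Theta c x u v) w = \sum_(l < 3) wedge12 (eta l) (Phi S l) c x u v w.
Proof.
move=> cx; have ijk : even_perm3 0 1 2%:R by [].
rewrite (sum_even_perm3 _ ijk) (ThetaE _ _ _ _ ijk) /wedge12 /Phi.
rewrite !(ac_rules hS cx ijk).
by do 3!rewrite [g c x w (phi _ c x u)]ac_gC// (ac_g_phi hS cx); ring.
Qed.

(** Multiplied by b/2, the first term on the right cancels the covariant derivative of phi_i for the
    canonical connection; the other two are the Sasaki-like right-hand side with a = -b/2. *)
Lemma Theta_phi i j k c x v w : even_perm3 i j k -> cimg M c x ->
  Theta c x v (phi i c x w) - phi i c x (Theta c x v w) =
  - 2 *: (eta k c x v *: phi j c x w - eta j c x v *: phi k c x w)
  + eta i c x w *: v - g c x v w *: xi i c x.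
Proof.
move=> ijk cx; apply: (ac_g_ext hS cx) => t.
rewrite !(ThetaE _ _ _ _ ijk) !(ac_rules hS cx ijk).
by ring.
Qed.

Lemma Theta_skew : skew_tensor12 g Theta.
Proof.
move=> c x u v w cx; have ijk : even_perm3 0 1 2%:R by [].
rewrite !(ThetaE _ _ _ _ ijk) !(ac_rules hS cx ijk).
have C l s t : g c x s (phi l c x t) = - g c x t (phi l c x s).
  by rewrite (ac_gC hS cx) (ac_g_phi hS cx).
by rewrite !(C _ w v) !(C _ v u); split; ring.
Qed.

Lemma Theta_tensor12 : is_tensor12 Theta.
Proof.
have pl l : is_tensor11 (phi l) by exact: ac_phi_tensor.
have el l : is_oneform (eta l) by exact: ac_eta_oneform.
have xl l : is_vfield (xi l) by exact: ac_xi_vfield.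
have [tg _ _] := ac_metric hS.
have ijk : even_perm3 0 1 2%:R by [].
split.
- move=> c x u cx; split=> a v w; rewrite !(ThetaE _ _ _ _ ijk);
    apply: (ac_g_ext hS cx) => t; rewrite !(ac_rules hS cx ijk); ring.
- move=> c u v; have oU := @cimg_open _ _ M c.
  apply: (smooth_sum oU) => l; have [_ sp _] := pl l; have [_ se _] := el l.
  have [sx _] := xl l; apply: (smoothD oU); first apply: (smoothB oU).
  + by apply: (smooth_scale oU).
  + by apply: (smooth_scale oU).
  + apply: (smooth_scale oU) => //.
    have [_ sg _] := tg.
    apply: (linear_smooth_apply (W := R) oU (f := fun x => g c x u)) => //.
      by move=> x cx; exact: tensor02_linearr.
- move=> c d x u v cdx; rewrite (linear_for_sum (push_linear cdx)).
  apply: eq_bigr => l _; have [_ _ tp] := pl l; have [_ _ te] := el l.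
  have [_ tx] := xl l; have [_ _ tt] := tg.
  rewrite (linear_forD (push_linear cdx)) (linear_forB (push_linear cdx)).
  rewrite !(linear_forZ (push_linear cdx)).
  by rewrite tx// !te// !tp// tt.
Qed.

(** The vector-valued 2-form that g associates with eta_1 /\ eta_2 /\ eta_3. *)
Definition Omega : tensor12 M := fun c x u v =>
  wedge11 (eta 1) (eta 2%:R) c x u v *: xi 0 c x
  + wedge11 (eta 2%:R) (eta 0) c x u v *: xi 1 c x
  + wedge11 (eta 0) (eta 1) c x u v *: xi 2%:R c x.

Lemma OmegaE i j k c x u v : even_perm3 i j k -> Omega c x u v =
  wedge11 (eta j) (eta k) c x u v *: xi i c x
  + wedge11 (eta k) (eta i) c x u v *: xi j c x
  + wedge11 (eta i) (eta j) c x u v *: xi k c x.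
Proof.
move=> /even_perm3_cases[] [-> -> ->] //; rewrite /Omega; first by rewrite -addrA [LHS]addrC.
by rewrite [LHS]addrC addrA.
Qed.

End Theta.

(** * The almost hermitian structures of the cone *)

Section HermitianCone.
Context {R : realType} {m : nat} {M : manifold R m} {S : contact3 M} {a : R}.
Hypotheses (hS : almost_3contact_metric S) (a0 : a != 0).
Local Notation E := 'rV[R]_m.
Local Notation E1 := 'rV[R]_(m + 1).
Local Notation g := (ac_g S).
Local Notation phi := (ac_phi S).
Local Notation xi := (ac_xi S).
Local Notation eta := (ac_eta S).
Local Notation h := (cone_metric a g).
Local Notation J := (coneJ a S).

Let mg : is_metric g := ac_metric hS.
Let tg : is_tensor02 g. Proof. by case: mg. Qed.

Definition coneJ_sign (i : 'I_3) : R := if i == 2%:R then -1 else 1.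

Lemma coneJ_sign_sq i : coneJ_sign i * coneJ_sign i = 1.
Proof. by rewrite /coneJ_sign; case: ifP; rewrite ?mulrNN mulr1. Qed.

Lemma coneJE i c (y w : E1) : cimg (cone M) c y ->
  J i c y w = coneJ_sign i *:
    cpair ((rpart w / a) *: ((rpart y)^-1 *: xi i c (mpart y)) - phi i c (mpart y) (mpart w))
          (- a * (rpart y * eta i c (mpart y) (mpart w))).
Proof.
move=> [cy y0]; rewrite /coneJ -/(coneJ_sign i) -/(cpair _ _).
rewrite !(ac_linear hS cy) (ac_phi_xi hS cy) scaler0 subr0.
apply: cone_vector_ext; rewrite !mpart_rpartE; last by ring.
by rewrite scalerA invfM mulrA.
Qed.

Lemma coneJ_tensor11 i : is_tensor11 (J i).
Proof.
have oU c := @cimg_open _ _ (cone M) c.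
have [_ sp tp] := ac_phi_tensor hS i; have [_ se te] := ac_eta_oneform hS i.
have [sx tx] := ac_xi_vfield hS i.
split.
- move=> c y [cy y0] k u v; rewrite !coneJE//.
  apply: cone_vector_ext; rewrite !mpart_rpartE !(ac_linear hS cy).
    by apply/rowP => j; rewrite !mxE; ring.
  by ring.
- move=> c v.
  apply: (smooth_ext (oU c) (f := fun y : E1 => coneJ_sign i *:
    cpair ((rpart v / a) *: ((rpart y)^-1 *: xi i c (mpart y)) - phi i c (mpart y) (mpart v))
          (- a * (rpart y * eta i c (mpart y) (mpart v))))).
    by move=> y cy; rewrite coneJE.
  apply: (smoothZ (oU c)); apply: smooth_cpair.
    apply: (smoothB (oU c)); last by apply: (smooth_mpart (f := fun x => phi i c x _)).
    apply: (smoothZ (oU c)); apply: (smooth_scale (oU c)); first exact: smooth_rpart_inv.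
    exact: smooth_mpart.
  apply: (smoothM (oU c)); first exact: smooth_cst.
  apply: (smoothM (oU c)); first exact: smooth_rpart.
  exact: (smooth_mpart (f := fun x => eta i c x (mpart v))).
- move=> c d y v cdy; have [cdx y0] := cone_overlap cdy.
  have cy : cimg (cone M) c y by case: cdy.
  rewrite coneJE; last exact: transition_cimg.
  rewrite coneJE// (cone_transition cdy) !(cone_push _ cdy) !mpart_rpartE.
  rewrite tx// tp// te// (linear_forZ (push_linear cdx)) (linear_forB (push_linear cdx)).
  rewrite !(linear_forZ (push_linear cdx)).
  by apply: cone_vector_ext; rewrite !mpart_rpartE.
Qed.

Section Point.
Context {c : chart M} {y : E1} (cy : cimg (cone M) c y).

Lemma coneJ_J i w : J i c y (J i c y w) = - w.
Proof.
have [cx y0] := cone_cimgP cy; have y1 : rpart y != 0 by rewrite gt_eqF.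
rewrite !coneJE//; apply: cone_vector_ext; rewrite !mpart_rpartE !(ac_linear hS cx) !(ac_rules1 hS cx).
  move: (mpart w) => u; apply/rowP => j; rewrite !mxE; have s := coneJ_sign_sq i.
  transitivity (coneJ_sign i * coneJ_sign i * - u 0 j); last by rewrite s mul1r.
  by field; rewrite a0 y1.
have s := coneJ_sign_sq i.
transitivity (coneJ_sign i * coneJ_sign i * - rpart w); last by rewrite s mul1r.
by field; rewrite a0 y1.
Qed.

Lemma coneJ_isometry i v w : h c y (J i c y v) (J i c y w) = h c y v w.
Proof.
have [cx y0] := cone_cimgP cy; have y1 : rpart y != 0 by rewrite gt_eqF.
rewrite !coneJE// /cone_metric !mpart_rpartE !(tensor02_bilin tg cx) (ac_g_phi_phi hS cx).
rewrite !(ac_rules1 hS cx).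
rewrite -[RHS]mul1r -[X in _ = X * _](coneJ_sign_sq i).
rewrite !(tensor02_bilin tg cx).
by field; rewrite a0 y1.
Qed.

(** On horizontal vectors J_1 and J_2 are -phi_1 and -phi_2, with product phi_1 phi_2 = phi_3; this
    is why the third structure carries the opposite sign. *)
Lemma coneJ_quaternion w : J 0 c y (J 1 c y w) = J 2%:R c y w /\
  J 2%:R c y w = - J 1 c y (J 0 c y w).
Proof.
have [cx y0] := cone_cimgP cy; have y1 : rpart y != 0 by rewrite gt_eqF.
have ijk : even_perm3 0 1 2%:R by [].
rewrite !coneJE// /coneJ_sign /=; split; apply: cone_vector_ext;
  rewrite !mpart_rpartE !(ac_rules hS cx ijk); move: (mpart w) => u; try (apply/rowP => j; rewrite !mxE);
  by field; rewrite a0 y1.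
Qed.
End Point.

Lemma coneJ_almost_hermitian i : almost_hermitian h (J i).
Proof.
split; first exact: coneJ_tensor11.
  by move=> c y u cy; exact: coneJ_J.
by move=> c y u v cy; exact: coneJ_isometry.
Qed.

Section Parallel.
Variable G : tensor12 M.
Hypothesis gG : metric_connection g G.
(** For any metric connection, differentiating phi_i xi_i = 0 expresses phi_i of the derivative [q]
    of xi_i by the derivative of phi_i. As [q] is orthogonal to xi_i, applying phi_i once more
    recovers [q]. *)
Lemma nabla_xi i c x v : cimg M c x ->
  'D_v (xi i c) x + G c x v (xi i c x) =
  phi i c x ('D_v (fun y => phi i c y (xi i c x)) x - phi i c x (G c x v (xi i c x))).
Proof.
move=> cx; have oU := @cimg_open _ _ M c.
have [lp sp _] := ac_phi_tensor hS i; have [sx _] := ac_xi_vfield hS i.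
have dx : differentiable (xi i c) x := smooth_differentiable (sx c) cx.
set q := _ + _.
have pq : phi i c x q =
    - ('D_v (fun y => phi i c y (xi i c x)) x - phi i c x (G c x v (xi i c x))).
  have : 'D_v (fun y => phi i c y (xi i c y)) x = 0.
    rewrite (derive_ext v oU cx (g := cst 0)) ?derive_cst// => y cy.
    by rewrite ac_phi_xi.
  rewrite (derive_linear_apply oU v cx _ _ dx); [|by move=> z cz; exact: lp|exact: sp].
  rewrite /q (ac_linear hS cx); move: ('D_v _ x) => p1.
  move: (phi i c x ('D_v _ x)) (phi i c x (G _ _ _ _)) => p2 p3 h1.
  by apply/rowP => j; move: h1 => /rowP/(_ j); rewrite !mxE; lra.
(* Differentiate g(xi_i, xi_i) = 1. *)
have eq0 : eta i c x q = 0.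
  have := gG.2 c (cst v) (xi i c) (xi i c) x (smooth_cst _ v) (sx c) (sx c) cx.
  rewrite -/q !(ac_rules1 hS cx) (derive_ext (W := R) _ oU cx (g := cst 1)).
    by rewrite derive_cst /nabla -/q; lra.
  by move=> z cz; rewrite !(ac_rules1 hS cz).
clearbody q; have := congr1 (phi i c x) pq.
rewrite [in LHS](ac_rules1 hS cx) eq0 scale0r addr0 [in RHS](linear_forN (lp c x cx)).
by move/oppr_inj.
Qed.

Lemma derive_eta i c x v w : cimg M c x ->
  'D_v (fun y => eta i c y w) x = eta i c x (G c x v w)
    + g c x w ('D_v (xi i c) x + G c x v (xi i c x)).
Proof.
move=> cx; have [sx _] := ac_xi_vfield hS i.
have := gG.2 c (cst v) (cst w) (xi i c) x (smooth_cst _ v) (smooth_cst _ w) (sx c) cx.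
rewrite /nabla derive_cst add0r /= (derive_ext (W := R) v (@cimg_open _ _ M c) cx
  (g := fun y => eta i c y w)); last by move=> z cz; rewrite (ac_rules1 hS cz).
by move=> ->; rewrite (ac_rules1 hS cx).
Qed.

(** The Sasaki-like identity for [G]; for the deformed connection it is provided by
    [deformed_phi]. *)
Hypothesis Dphi : forall i c x v w, cimg M c x ->
  'D_v (fun y => phi i c y w) x + G c x v (phi i c x w) - phi i c x (G c x v w) =
  a *: (g c x v w *: xi i c x - eta i c x w *: v).

Lemma cone_condition_xi i c x v : cimg M c x ->
  'D_v (xi i c) x + G c x v (xi i c x) = - a *: phi i c x v.
Proof.
move=> cx; rewrite nabla_xi//; have [[Gl _ _] _] := gG.
have := Dphi i v (xi i c x) cx; rewrite (ac_phi_xi hS cx) (linear_for0 (Gl c x v cx).1).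
rewrite addr0 => ->; rewrite !(ac_linear hS cx, ac_rules1 hS cx) scaler0 scale1r.
by rewrite sub0r scalerN scaleNr.
Qed.

Lemma cone_condition_eta i c x v w : cimg M c x ->
  'D_v (fun y => eta i c y w) x - eta i c x (G c x v w) = a * g c x v (phi i c x w).
Proof.
move=> cx; rewrite derive_eta// cone_condition_xi// !(tensor02_bilin tg cx).
by rewrite (ac_gC hS cx w) (ac_g_phi hS cx); ring.
Qed.

Lemma derive_coneJ i c (y u v : E1) : cimg (cone M) c y ->
  let x := mpart y in let r := rpart y in
  'D_u (fun y => J i c y v) y = coneJ_sign i *:
    cpair ((rpart v / a) *: (r^-1 *: 'D_(mpart u) (xi i c) x
                             - (rpart u * r^-1 ^+ 2) *: xi i c x)
           - 'D_(mpart u) (fun x => phi i c x (mpart v)) x)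
          (- a * (r * 'D_(mpart u) (fun x => eta i c x (mpart v)) x
                  + rpart u * eta i c x (mpart v))).
Proof.
move=> cy x r; have [cx y0] := cone_cimgP cy.
have oU := @cimg_open _ _ (cone M) c.
rewrite (derive_ext u oU cy (g := fun y => coneJ_sign i *:
    cpair ((rpart v / a) *: ((rpart y)^-1 *: xi i c (mpart y)) - phi i c (mpart y) (mpart v))
          (- a * (rpart y * eta i c (mpart y) (mpart v))))); last first.
  by move=> z cz; rewrite coneJE.
have [_ sp _] := ac_phi_tensor hS i; have [_ se _] := ac_eta_oneform hS i.
have [sx _] := ac_xi_vfield hS i.
have dx := smooth_differentiable (smooth_mpart (sx c)) cy.
have dp := smooth_differentiable (smooth_mpart (sp c (mpart v))) cy.
have de := smooth_differentiable (smooth_mpart (W := R) (se c (mpart v))) cy.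
have dr : differentiable (@rpart R m) y := differentiable_rpart y.
have dri := smooth_differentiable (@smooth_rpart_inv _ _ M c) cy.
have drx := differentiable_scale dri dx.
have dre := differentiable_scale (W := R) dr de.
have Drx : 'D_u (fun y : E1 => (rpart y)^-1 *: xi i c (mpart y)) y =
    r^-1 *: 'D_(mpart u) (xi i c) x - (rpart u * r^-1 ^+ 2) *: xi i c x.
  rewrite derive_scale// (derive_mpart u (smooth_differentiable (sx c) cx)).
  rewrite (deriveV (f := @rpart R m)) ?gt_eqF//; last exact: diff_derivable.
  by rewrite derive_rpart !scaleNr; congr (_ - _ *: _); rewrite exprVn; exact: mulrC.
have Dre : 'D_u (fun y : E1 => rpart y * eta i c (mpart y) (mpart v)) y =
    r * 'D_(mpart u) (fun x => eta i c x (mpart v)) x + rpart u * eta i c x (mpart v).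
  rewrite (derive_scale (W := R) u dr de) derive_rpart.
  by rewrite (derive_mpart u (smooth_differentiable (se c (mpart v)) cx)).
have Dp := derive_mpart u (smooth_differentiable (sp c (mpart v)) cx).
have dA : differentiable (fun y : E1 => (rpart v / a) *: ((rpart y)^-1 *: xi i c (mpart y))
   - phi i c (mpart y) (mpart v)) y.
  by apply: differentiableB => //; exact: differentiableZ.
have dB : differentiable (fun y : E1 => - a * (rpart y * eta i c (mpart y) (mpart v))) y.
  exact: (differentiableZ (W := R) (- a) dre).
rewrite (deriveZ (f := fun y : E1 => cpair _ _)); last first.
  by apply: diff_derivable; exact: differentiable_cpair.
rewrite derive_cpair//; congr (_ *: cpair _ _).
  rewrite deriveB; [|by apply/diff_derivable/differentiableZ|exact: diff_derivable].
  by rewrite deriveZ ?Drx ?Dp//; exact: diff_derivable.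
by rewrite (deriveZ (W := R) (f := fun y : E1 => rpart y * eta i c (mpart y) (mpart v)));
  [rewrite Dre|exact: diff_derivable].
Qed.

(** The identities for the derivatives of xi_i, phi_i and eta_i replace all derivatives by
    Christoffel symbols and algebraic terms; these cancel separately in the tangential and in the
    radial component. *)
Lemma coneJ_parallel i D : is_connection D ->
  (forall c y v w, cimg (cone M) c y -> D c y v w = cone_connection a g G c y v w) ->
  parallel11 D (J i).
Proof.
move=> cD DE; have [lG _ _] := gG.1.
apply/(parallel11P (coneJ_tensor11 i) cD) => c y u v cy.
have [cx y0] := cone_cimgP cy; have y1 : rpart y != 0 by rewrite gt_eqF.
rewrite !DE// derive_coneJ//= /cone_connection !coneJE//.
have lr w := (linear_forD (lG c (mpart y) w cx).1, linear_forB (lG c (mpart y) w cx).1,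
  linear_forZ (lG c (mpart y) w cx).1, linear_forN (lG c (mpart y) w cx).1).
have e1 := cone_condition_xi i (mpart u) cx.
have e2 := Dphi i (mpart u) (mpart v) cx.
have e3 := cone_condition_eta i (mpart u) (mpart v) cx.
have {e1}-> : 'D_(mpart u) (xi i c) (mpart y) =
    - a *: phi i c (mpart y) (mpart u) - G c (mpart y) (mpart u) (xi i c (mpart y)).
  by rewrite -e1 addrK.
have {e2}-> : 'D_(mpart u) (fun x => phi i c x (mpart v)) (mpart y) =
    a *: (g c (mpart y) (mpart u) (mpart v) *: xi i c (mpart y)
          - eta i c (mpart y) (mpart v) *: mpart u)
    + phi i c (mpart y) (G c (mpart y) (mpart u) (mpart v))
    - G c (mpart y) (mpart u) (phi i c (mpart y) (mpart v)).
  by rewrite -e2 subrK addrK.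
have {e3}-> : 'D_(mpart u) (fun x => eta i c x (mpart v)) (mpart y) =
    a * g c (mpart y) (mpart u) (phi i c (mpart y) (mpart v))
    + eta i c (mpart y) (G c (mpart y) (mpart u) (mpart v)).
  by rewrite -e3 subrK.
apply: cone_vector_ext; rewrite !mpart_rpartE ?lr ?(ac_linear hS cx) ?(tensor02_bilin tg cx)
   ?(ac_rules1 hS cx).
  move: (mpart u) (mpart v) => u' v'.
  by apply/rowP => j; rewrite !mxE; field; rewrite a0 y1.
by field; rewrite a0 y1.
Qed.

End Parallel.
End HermitianCone.

(** * The Nijenhuis tensor of a parallel almost complex structure *)

Section NijenhuisTorsion.
Context {R : realType} {m : nat} {M : manifold R m}.

(** Write each bracket as a difference of covariant derivatives minus torsion. Since J commutes with
    the covariant derivative and squares to -1, the derivatives cancel and only torsion terms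
    remain. *)
Lemma nijenhuis_torsion (G T : tensor12 M) (J : tensor11 M) c X Y x :
  is_connection G -> has_torsion G T -> is_tensor11 J -> parallel11 G J ->
  (forall c x u, cimg M c x -> J c x (J c x u) = - u) ->
  local_vf c X -> local_vf c Y -> cimg M c x ->
  nijenhuis J c X Y x =
    T c x (X x) (Y x) - T c x (J c x (X x)) (J c x (Y x))
    + J c x (T c x (J c x (X x)) (Y x) + T c x (X x) (J c x (Y x))).
Proof.
move=> cG GT tJ pJ JJ sX sY cx.
have lJ : linear (J c x) by case: tJ => + _ _; exact.
have sJX := app11_smooth tJ sX; have sJY := app11_smooth tJ sY.
have lieE (Z W : 'rV[R]_m -> 'rV[R]_m) : local_vf c Z -> local_vf c W ->
    lie Z W x = nabla G c Z W x - nabla G c W Z x - T c x (Z x) (W x).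
  by move=> sZ sW; rewrite -(GT c Z W x)// opprB addrC subrK.
have nJ (Z W : 'rV[R]_m -> 'rV[R]_m) : local_vf c Z -> local_vf c W ->
    nabla G c Z (app11 J c W) x = J c x (nabla G c Z W x).
  by move=> sZ sW; apply/eqP; rewrite -subr_eq0; apply/eqP; exact: pJ.
rewrite /nijenhuis !lieE// !nJ//.
rewrite !(linear_forD lJ, linear_forB lJ, linear_forN lJ) !JJ//.
rewrite /app11; move: (nabla G c) => n.
apply/rowP => j; rewrite !mxE; ring.
Qed.

End NijenhuisTorsion.

(** * The torsion of the canonical connection *)

Section CanonicalTorsion.
Context {R : realType} {m : nat} {M : manifold R m} {S : contact3 M}.
Context {beta : M -> R} {b : R} {nab T : tensor12 M}.
Hypotheses (hS : almost_3contact_metric S) (hnab : canonical_connection S beta nab T).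
Hypothesis hbeta : forall p, beta p = b.
Local Notation E := 'rV[R]_m.
Local Notation g := (ac_g S).
Local Notation phi := (ac_phi S).
Local Notation xi := (ac_xi S).
Local Notation eta := (ac_eta S).

Let mg : is_metric g := ac_metric hS.
Let tg : is_tensor02 g. Proof. by case: mg. Qed.
Let skew_nab : skew_torsion_connection g nab T := proj1 hnab.
Let metric_nab : metric_connection g nab. Proof. by case: skew_nab. Qed.
Let nabT : forall c x u v, cimg M c x -> nab c x u v - nab c x v u = T c x u v.
Proof. by case: skew_nab => _ _ /has_torsionP. Qed.
Let skewT : skew_tensor12 g T. Proof. by case: skew_nab. Qed.

Lemma canonical_phi i j k c x v w : even_perm3 i j k -> cimg M c x ->
  'D_v (fun y => phi i c y w) x + nab c x v (phi i c x w) - phi i c x (nab c x v w) =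
  b *: (eta k c x v *: phi j c x w - eta j c x v *: phi k c x w).
Proof.
move=> ijk cx.
have := hnab.2 i j k ijk c (cst v) (cst w) x (smooth_cst _ v) (smooth_cst _ w) cx.
by rewrite (nabla11E _ (ac_phi_tensor hS i) metric_nab.1 cx (smooth_cst _ w)) hbeta.
Qed.

Lemma canonical_xi i j k c x v : even_perm3 i j k -> cimg M c x ->
  'D_v (xi i c) x + nab c x v (xi i c x) =
  b *: (eta k c x v *: xi j c x - eta j c x v *: xi k c x).
Proof.
move=> ijk cx; rewrite (nabla_xi hS metric_nab)//; have [[Gl _ _] _] := metric_nab.
have := canonical_phi v (xi i c x) ijk cx.
rewrite (ac_phi_xi hS cx) (linear_for0 (Gl c x v cx).1) addr0 => ->.
rewrite !(ac_rules hS cx ijk); apply/rowP => l; rewrite !mxE; ring.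
Qed.

Section Deformation.
Context {nab' T' : tensor12 M}.
Hypothesis hnab' : skew_torsion_connection g nab' T'.
Hypothesis hT' : forall c x u v w, cimg M c x ->
  g c x (T' c x u v) w = g c x (T c x u v) w
    + b * \sum_(l < 3) wedge12 (eta l) (Phi S l) c x u v w.

Lemma deformed_torsion c x u v : cimg M c x ->
  T' c x u v = T c x u v + b *: Theta S c x u v.
Proof.
move=> cx; apply: (ac_g_ext hS cx) => w.
by rewrite hT'// !(tensor02_bilin tg cx) g_Theta.
Qed.

(** Combines [canonical_phi] with [Theta_phi], the deformation being (b/2) [Theta] by uniqueness of
    metric connections with given skew torsion. *)
Lemma deformed_phi i c x v w : cimg M c x ->
  'D_v (fun y => phi i c y w) x + nab' c x v (phi i c x w) - phi i c x (nab' c x v w) =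
  (- b / 2) *: (g c x v w *: xi i c x - eta i c x w *: v).
Proof.
move=> cx; have [j [k ijk]] := even_perm3_ex i.
have [gn _ nT sT] := skew_nab; have [gn' _ n'T sT'] := hnab'.
rewrite !(skew_torsion_unique mg gn nT sT gn' n'T sT' _ _ cx) !deformed_torsion//.
have := canonical_phi v w ijk cx; have := Theta_phi hS v w ijk cx.
rewrite !(ac_linear hS cx).
move: ('D_v _ x) (phi i c x (Theta _ _ _ _ _)) (phi i c x (nab _ _ _ _)) => p1 p2 p3.
move: (phi i c x (T _ _ _ _)) => p4 h1 h2.
apply/rowP => l; move: h1 h2 => /rowP/(_ l) + /rowP/(_ l); rewrite !mxE.
by move=> /(congr1 ( *%R (b / 2))); lra.
Qed.

End Deformation.

Section Sasaki.
Context {alpha delta : R}.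
Hypothesis hsas : three_alpha_delta_sasaki S alpha delta.

Lemma sasaki_deta i j k c x u v : even_perm3 i j k -> cimg M c x ->
  'D_u (fun y => eta i c y v) x - 'D_v (fun y => eta i c y u) x =
  2 * alpha * g c x u (phi i c x v)
  + 2 * (alpha - delta) * (eta j c x u * eta k c x v - eta j c x v * eta k c x u).
Proof.
move=> ijk cx.
have := hsas.2 i j k ijk c (cst u) (cst v) x (smooth_cst _ u) (smooth_cst _ v) cx.
rewrite /ext1 /lie !derive_cst subrr (ac_linear hS cx) subr0 => ->.
by [].
Qed.

(** Skew-symmetrizing [derive_eta] gives d eta_i as eta_i of the torsion plus terms in the
    derivative of xi_i. By [canonical_xi] the latter are -2b eta_j /\ eta_k, whence the shift by
    b. *)
Lemma sasaki_eta_torsion i j k c x u v : even_perm3 i j k -> cimg M c x ->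
  eta i c x (T c x u v) = 2 * alpha * g c x u (phi i c x v)
    + 2 * (alpha - delta + b) * (eta j c x u * eta k c x v - eta j c x v * eta k c x u).
Proof.
move=> ijk cx; have := sasaki_deta u v ijk cx.
rewrite !(derive_eta hS metric_nab)// !(canonical_xi _ ijk)//.
rewrite -nabT// !(ac_rules hS cx ijk).
by lra.
Qed.

(* d(d eta_1) = 0 evaluated on horizontal vectors; the derivative of
   [eta_2 /\ eta_3] vanishes there. *)
Lemma sasaki_torsion_cyclic c x u v w : cimg M c x ->
  (forall l, eta l c x u = 0) -> (forall l, eta l c x v = 0) ->
  (forall l, eta l c x w = 0) ->
  g c x (T c x w u) (phi 0 c x v) + g c x (T c x u v) (phi 0 c x w)
  + g c x (T c x v w) (phi 0 c x u) = 0.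
Proof.
move=> cx; have ijk : even_perm3 0 1 2%:R by [].
have oU := @cimg_open _ _ M c.
have se l z : smooth_on (cimg M c) (fun y => eta l c y z).
  by case: (ac_eta_oneform hS l).
have de l z y : cimg M c y -> differentiable (fun y => eta l c y z) y.
  exact: smooth_differentiable (se l z).
have sD l z s : smooth_on (cimg M c) (fun y => 'D_s (fun y => eta l c y z) y).
  exact: smooth_derive (se l z).
have [_ sg _] := tg; have [lp sp _] := ac_phi_tensor hS 0.
have sphi s t : smooth_on (cimg M c) (fun y => g c y s (phi 0 c y t)).
  apply: (linear_smooth_apply (W := R) oU (f := fun y => g c y s)) => //.
  by move=> y cy; exact: tensor02_linearr.
(* The symmetry of [A] in its first two arguments is d(d eta_1) = 0 in coordinates. *)
pose A r s t := 'D_r (fun y => 'D_s (fun y => eta 0 c y t) y) x.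
have AC r s t : A r s t = A s r t by exact: schwarz oU cx (se 0 t).
have key s t r : (forall l, eta l c x s = 0) -> (forall l, eta l c x t = 0) ->
    (forall l, eta l c x r = 0) ->
    A r s t - A r t s
    = 2 * alpha * (g c x (nab c x r s) (phi 0 c x t) - g c x (nab c x r t) (phi 0 c x s)).
  move=> hs ht hr.
  have dst q p : differentiable (fun y => 'D_p (fun y => eta 0 c y q) y) x.
    exact: smooth_differentiable (sD 0 q p) cx.
  have -> : A r s t - A r t s = 'D_r (fun y => 2 * alpha * g c y s (phi 0 c y t)
      + 2 * (alpha - delta) * (eta 1 c y s * eta 2%:R c y t - eta 1 c y t * eta 2%:R c y s)) x.
    rewrite -deriveB; [|exact: diff_derivable|exact: diff_derivable].
    by apply: (derive_ext (W := R) r oU cx) => y cy; exact: sasaki_deta ijk cy.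
  have dphi : differentiable (fun y => g c y s (phi 0 c y t)) x.
    exact: smooth_differentiable (sphi s t) cx.
  have dwedge q p : differentiable (fun y => eta 1 c y q * eta 2%:R c y p) x.
    by apply: (differentiable_scale (W := R)); exact: de.
  (* Each Leibniz term keeps an underived factor, which is zero at x on horizontal vectors. *)
  have Dwedge q p : (forall l, eta l c x q = 0) -> (forall l, eta l c x p = 0) ->
      'D_r (fun y => eta 1 c y q * eta 2%:R c y p) x = 0.
    move=> hq hp; rewrite (derive_scale (W := R) r (de 1 q x cx) (de 2%:R p x cx)).
    by rewrite hq hp scale0r add0r scaler0.
  rewrite (deriveD (f := fun y => 2 * alpha * g c y s (phi 0 c y t))
    (g := fun y => 2 * (alpha - delta) *
      (eta 1 c y s * eta 2%:R c y t - eta 1 c y t * eta 2%:R c y s))); first last.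
  - apply: diff_derivable; apply: (differentiableZ (W := R)).
    by apply: differentiableB; exact: dwedge.
  - by apply: diff_derivable; exact: (differentiableZ (W := R)).
  rewrite (deriveZ (W := R) (f := fun y => g c y s (phi 0 c y t))); last first.
    exact: diff_derivable.
  rewrite (deriveZ (W := R) (f := fun y =>
      eta 1 c y s * eta 2%:R c y t - eta 1 c y t * eta 2%:R c y s)); last first.
    by apply: diff_derivable; apply: differentiableB; exact: dwedge.
  rewrite (deriveB (f := fun y => eta 1 c y s * eta 2%:R c y t)); first last.
  - by apply: diff_derivable; exact: dwedge.
  - by apply: diff_derivable; exact: dwedge.
  rewrite !Dwedge// subrr scaler0 addr0; congr (_ * _).
  have sphit : local_vf c (app11 (phi 0) c (cst t)).
    by apply: app11_smooth; [exact: ac_phi_tensor|exact: smooth_cst].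
  rewrite (metric_nab.2 c (cst r) (cst s) _ x (smooth_cst _ r) (smooth_cst _ s) sphit cx).
  rewrite /nabla derive_cst add0r /app11 /=.
  (* Along a horizontal r the covariant derivative of phi_1 vanishes. *)
  have /eqP := canonical_phi r t ijk cx.
  rewrite !hr !scale0r subrr scaler0 subr_eq0 => /eqP ->.
  by rewrite (ac_gC hS cx s) (ac_g_phi hS cx).
clearbody A.
have hT s t r : g c x (T c x s t) r = g c x (nab c x s t) r - g c x (nab c x t s) r.
  by rewrite -nabT// !(tensor02_bilin tg cx).
move=> hu hv hw; rewrite !hT; have [alpha0 _] := hsas.
have := key u v w hu hv hw; have := key v w u hv hw hu.
have := key w u v hw hu hv.
(* In the cyclic sum of [key] the second derivatives cancel in pairs, and the common factor 2 alpha
   is nonzero. *)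
rewrite (AC u v w) (AC v w u) (AC w u v) => k1 k2 k3.
have : 2 * alpha != 0 by rewrite mulf_neq0// pnatr_eq0.
move/mulfI; apply; rewrite mulr0; lra.
Qed.

(** By skewness the cyclic identity says that the derivation induced by phi_1 kills the horizontal
    torsion. Since phi_1 preserves the horizontal space and squares to -1 there, every horizontal
    vector is, up to sign, phi_1 of a horizontal one. *)
Lemma sasaki_torsion_horizontal c x u v w : cimg M c x ->
  (forall l, eta l c x u = 0) -> (forall l, eta l c x v = 0) ->
  (forall l, eta l c x w = 0) -> g c x (T c x u v) w = 0.
Proof.
move=> cx; have ijk : even_perm3 0 1 2%:R by [].
pose H s := forall l, eta l c x s = 0.
have Hphi s : H s -> H (phi 0 c x s).
  move=> hs l; have [->|->|->] : [\/ l = 0, l = 1 | l = 2%:R].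
    by have [j [k /even_perm3_cases[] [-> _ _]]] := even_perm3_ex l;
      [constructor 1|constructor 2|constructor 3].
  - by rewrite (ac_rules1 hS cx).
  - by rewrite (ac_rules hS cx ijk) hs oppr0.
  - by rewrite (ac_rules hS cx ijk) hs.
have phi2 s : H s -> phi 0 c x (phi 0 c x s) = - s.
  by move=> hs; rewrite (ac_rules1 hS cx) hs scale0r addr0.
pose t s1 s2 s3 := g c x (T c x s1 s2) s3.
have t12 s1 s2 s3 : t s1 s2 s3 = - t s2 s1 s3 by have [] := skewT s1 s2 s3 cx.
have t23 s1 s2 s3 : t s1 s2 s3 = - t s1 s3 s2 by have [] := skewT s1 s2 s3 cx.
have tN s1 s2 s3 : t s1 s2 (- s3) = - t s1 s2 s3.
  by rewrite /t (tensor02_bilin tg cx).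
have cyc s1 s2 s3 : H s1 -> H s2 -> H s3 ->
    t s1 s2 (phi 0 c x s3) + t s2 s3 (phi 0 c x s1) + t s3 s1 (phi 0 c x s2) = 0.
  by move=> h1 h2 h3; have := sasaki_torsion_cyclic cx h1 h2 h3; rewrite /t; lra.
have tM s1 s2 s3 : t s1 (- s2) s3 = - t s1 s2 s3 by rewrite t23 tN t23 opprK.
have tL s1 s2 s3 : t (- s1) s2 s3 = - t s1 s2 s3 by rewrite t12 tM t12 opprK.
have rot s1 s2 s3 : t s1 s2 s3 = t s2 s3 s1 by rewrite t12 t23 opprK.
have der s1 s2 s3 : H s1 -> H s2 -> H s3 ->
    t (phi 0 c x s1) s2 s3 + t s1 (phi 0 c x s2) s3 + t s1 s2 (phi 0 c x s3) = 0.
  by move=> h1 h2 h3; rewrite (rot (phi _ _ _ _)) -[t s1 _ _]rot -(cyc _ _ _ h1 h2 h3); ring.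
(* A 3-form annihilated by the derivation induced by a complex structure is zero. *)
have t0 s1 s2 s3 : H s1 -> H s2 -> H s3 ->
    t (phi 0 c x s1) (phi 0 c x s2) (phi 0 c x s3) = 0.
  move=> h1 h2 h3; have p1 := Hphi _ h1; have p2 := Hphi _ h2; have p3 := Hphi _ h3.
  (* By the first identity, the values of [t] with phi_1 in exactly one slot add up to 0. As phi_1^2
     = -1, the other three identities add up to three times the value with phi_1 in all slots minus
     twice that sum. *)
  have := der _ _ _ h1 h2 h3; have := der _ _ _ p1 p2 h3.
  have := der _ _ _ p1 h2 p3; have := der _ _ _ h1 p2 p3.
  by rewrite !phi2// !(tL, tM, tN); lra.
move=> hu hv hw; have := t0 _ _ _ (Hphi _ hu) (Hphi _ hv) (Hphi _ hw).
by rewrite !phi2// !(tL, tM, tN) -/(t u v w); lra.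
Qed.

(** The defect [t] is totally skew and vanishes on each xi_l by [sasaki_eta_torsion], so only
    horizontal parts matter. There T vanishes by the previous lemma, and each term of [Theta] and
    [Omega] contains a contact form. *)
Lemma sasaki_torsionE c x u v : cimg M c x -> T c x u v =
  (2 * alpha) *: Theta S c x u v + (6 * alpha - 2 * delta + 2 * b) *: Omega S c x u v.
Proof.
move=> cx; have ijk : even_perm3 0 1 2%:R by [].
(* The xi_i-component of [Theta] is Phi_i - 2 eta_j /\ eta_k and that of [Omega] is eta_j /\ eta_k.
   Matching the torsion forces k2 = 2 k1 + 2 (alpha - delta + b). *)
set k1 := 2 * alpha; set k2 := 6 * alpha - _ + _.
pose t s1 s2 s3 := g c x (T c x s1 s2) s3 - k1 * g c x (Theta S c x s1 s2) s3
  - k2 * g c x (Omega S c x s1 s2) s3.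
have t12 s1 s2 s3 : t s1 s2 s3 = - t s2 s1 s3.
  have [T1 _] := skewT s1 s2 s3 cx; have [H1 _] := Theta_skew hS s1 s2 s3 cx.
  rewrite /t T1 H1 /Omega /wedge11 !(tensor02_bilin tg cx); ring.
have t23 s1 s2 s3 : t s1 s2 s3 = - t s1 s3 s2.
  have [_ T1] := skewT s1 s2 s3 cx; have [_ H1] := Theta_skew hS s1 s2 s3 cx.
  rewrite /t T1 H1 /Omega /wedge11 !(tensor02_bilin tg cx) !(ac_rules1 hS cx); ring.
have txi l s1 s2 : t s1 s2 (xi l c x) = 0.
  have [j [k ljk]] := even_perm3_ex l.
  rewrite /t (OmegaE _ _ _ _ _ ljk) (ThetaE _ _ _ _ _ ljk) /wedge11.
  rewrite [g c x (T _ _ _ _) _](ac_g_xi hS cx) (sasaki_eta_torsion _ _ ljk cx).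
  by rewrite !(ac_rules hS cx ljk) /k1 /k2; ring.
have tB s1 s2 a1 s3 a2 s4 a3 s5 s6 : t s1 s2 (s6 - (a1 *: s3 + a2 *: s4 + a3 *: s5)) =
    t s1 s2 s6 - (a1 * t s1 s2 s3 + a2 * t s1 s2 s4 + a3 * t s1 s2 s5).
  by rewrite /t !(tensor02_bilin tg cx); ring.
pose hor s := s - (eta 0 c x s *: xi 0 c x + eta 1 c x s *: xi 1 c x
  + eta 2%:R c x s *: xi 2%:R c x).
have thor s1 s2 s3 : t s1 s2 (hor s3) = t s1 s2 s3.
  by rewrite /hor tB !txi !mulr0 !addr0 subr0.
have hor_eta s l : eta l c x (hor s) = 0.
  have [j [k ljk]] := even_perm3_ex l.
  have -> : hor s = s - (eta l c x s *: xi l c x + eta j c x s *: xi j c x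
      + eta k c x s *: xi k c x).
    by rewrite /hor -!(sum_even_perm3 (fun l => eta l c x s *: xi l c x)).
  by rewrite !(ac_rules hS cx ljk); ring.
apply: (ac_g_ext hS cx) => w.
have : t u v w = 0.
  (* Skewness brings each argument in turn to the last slot, where it is replaced by its horizontal
     part. *)
  rewrite -thor t23 -thor t12 t23 -thor.
  rewrite /t (sasaki_torsion_horizontal cx) => [|l|l|l]; rewrite ?hor_eta//.
  have := hor_eta; clearbody hor => h0.
  rewrite (ThetaE _ _ _ _ _ ijk) /Omega /wedge11 !(ac_rules hS cx ijk) !h0.
  by ring.
by rewrite /t !(tensor02_bilin tg cx); lra.
Qed.

End Sasaki.
End CanonicalTorsion.

(** * Torsions for which the structures of the cone are integrable *)

Section TorsionType.
Context {R : realType} {m : nat} {M : manifold R m} {S : contact3 M}.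
Context {a kappa mu : R} {T : tensor12 M}.
Hypothesis hS : almost_3contact_metric S.
Hypothesis TE : forall c x u v, cimg M c x ->
  T c x u v = kappa *: Theta S c x u v + mu *: Omega S c x u v.
Local Notation E1 := 'rV[R]_(m + 1).
Local Notation J := (coneJ a S).
Local Notation phi := (ac_phi S).
Local Notation xi := (ac_xi S).
Local Notation eta := (ac_eta S).

Section Point.
Context {c : chart M} {x : 'rV[R]_m} (cx : cimg M c x) (i : 'I_3) (u v : 'rV[R]_m) (s t : R).
(** Up to the sign of J_i, [U] and [V] are the M-parts of the J_i-images of vectors with M-parts u,
    v and radial parts a r s, a r t. The two lemmas below are the radial and the tangential
    component of the vanishing of the Nijenhuis tensor. *)
Let U := s *: xi i c x - phi i c x u.
Let V := t *: xi i c x - phi i c x v.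

Lemma torsion_type_eta : eta i c x (T c x U v) + eta i c x (T c x u V) = 0.
Proof.
have [j [k ijk]] := even_perm3_ex i; rewrite !TE// /U /V.
rewrite !(ThetaE _ _ _ _ _ ijk) !(OmegaE _ _ _ _ _ ijk) /wedge11 !(ac_rules hS cx ijk).
by ring.
Qed.

Lemma torsion_type_phi :
  T c x u v - T c x U V = phi i c x (T c x U v) + phi i c x (T c x u V).
Proof.
have [j [k ijk]] := even_perm3_ex i; rewrite !TE// /U /V.
apply: (ac_g_ext hS cx) => w.
rewrite !(ThetaE _ _ _ _ _ ijk) !(OmegaE _ _ _ _ _ ijk) /wedge11 !(ac_rules hS cx ijk).
by ring.
Qed.
End Point.

(** This is the expression from [nijenhuis_torsion]. The sign of J_i occurs in it an even number of
    times in each term, hence drops out. *)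
Lemma coneJ_torsion_type i c (y u v : E1) : is_tensor12 T -> cimg (cone M) c y ->
  cone_lift T c y u v - cone_lift T c y (J i c y u) (J i c y v)
  + J i c y (cone_lift T c y (J i c y u) v + cone_lift T c y u (J i c y v)) = 0.
Proof.
move=> [lT _ _] cy; have [cx y0] := cone_cimgP cy.
have TZr k w z : T c (mpart y) w (k *: z) = k *: T c (mpart y) w z.
  exact: linear_forZ (lT c _ w cx).1 k z.
have TZl k w z : T c (mpart y) (k *: w) z = k *: T c (mpart y) w z.
  exact: linear_forZ (lT c _ z cx).2 k w.
rewrite !coneJE// /cone_lift !scalerA.
set s := rpart u / a / rpart y; set t := rpart v / a / rpart y.
have := torsion_type_eta cx i (mpart u) (mpart v) s t.
have := torsion_type_phi cx i (mpart u) (mpart v) s t.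
set U := s *: _ - _; set V := t *: _ - _ => ht he.
have ss := coneJ_sign_sq i.
apply: cone_vector_ext; rewrite !mpart_rpartE !(TZl, TZr) -?scalerDr !(ac_linear hS cx).
  rewrite !addr0 !mul0r scale0r sub0r scalerN !scalerA ss !scale1r ht.
  by rewrite subrr.
by rewrite he; ring.
Qed.
End TorsionType.

(** * The hermitian connection and the HKT structure of the cone *)

Section HKT.
Context {R : realType} {m : nat} {M : manifold R m} {S : contact3 M}.
Context {beta : M -> R} {b : R} {nab T : tensor12 M}.
Hypotheses (hS : almost_3contact_metric S) (hnab : canonical_connection S beta nab T).
Hypotheses (hbeta : forall p, beta p = b) (b0 : b != 0).
Local Notation g := (ac_g S).
Local Notation a := (- b / 2).
Local Notation h := (cone_metric a g).
Local Notation J := (coneJ a S).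

Let a0 : a != 0.
Proof. by rewrite mulf_neq0// ?oppr_eq0// invr_eq0 pnatr_eq0. Qed.
Let mg : is_metric g := ac_metric hS.
Let tg : is_tensor02 g. Proof. by case: mg. Qed.

Section Deformed.
Context {nab' T' : tensor12 M}.
Hypothesis hnab' : skew_torsion_connection g nab' T'.
Hypothesis hT' : forall c x u v w, cimg M c x ->
  g c x (T' c x u v) w = g c x (T c x u v) w
    + b * \sum_(l < 3) wedge12 (ac_eta S l) (Phi S l) c x u v w.

Lemma deformed_appendant_hermitian D : appendant a g T' D ->
  hermitian_connection h J D.
Proof.
move=> aD; have [hD _ _ _] := appendant_skew_torsion a0 mg hnab' aD.
split=> // i; have [gn' _ _ _] := hnab'.
apply: (coneJ_parallel hS a0 gn') => [l c x v w cx| |].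
- exact: (deformed_phi hS hnab hbeta hnab' hT').
- exact: hD.1.
- exact: appendantE hnab' aD.
Qed.
End Deformed.

Lemma cone_HKT alpha delta : three_alpha_delta_sasaki S alpha delta -> HKT h J.
Proof.
move=> hsas; have [skew_nab _] := hnab.
have tT := tensor12Z b (Theta_tensor12 hS).
have sT := skew_tensor12Z b tg (Theta_skew hS).
(* A connection with torsion T + b [Theta] is constructed here; its appendant connection will be the
   HKT connection. *)
have hnab' := skew_torsion_connection_add mg skew_nab tT sT.
set nab' := (fun c x u v => nab c x u v + _) in hnab'.
set T' := (fun c x u v => T c x u v + _) in hnab'.
have hT' c x u v w : cimg M c x -> g c x (T' c x u v) w = g c x (T c x u v) w
    + b * \sum_(l < 3) wedge12 (ac_eta S l) (Phi S l) c x u v w.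
  by move=> cx; rewrite /T' !(tensor02_bilin tg cx) g_Theta.
(* The deformation only changes the coefficient of [Theta], so the torsion keeps the form required
   by [coneJ_torsion_type]. *)
have T'E c x u v : cimg M c x -> T' c x u v =
    (2 * alpha + b) *: Theta S c x u v
    + (6 * alpha - 2 * delta + 2 * b) *: Omega S c x u v.
  move=> cx; rewrite /T' (sasaki_torsionE hS hnab hbeta hsas)//.
  by rewrite addrAC -scalerDl.
have [D aD] := appendant_exists a0 mg hnab'.
have hD := appendant_skew_torsion a0 mg hnab' aD.
have [_ pJ] := deformed_appendant_hermitian hnab' hT' aD.
split; last by exists D, (cone_lift T').
have [gD tD DT _] := hD.
split; first exact: cone_metric_is_metric.
  move=> i; have aJ := coneJ_almost_hermitian hS a0 i; have [tJ JJ _] := aJ; split=> //.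
  move=> c X Y x sX sY cx.
  rewrite (nijenhuis_torsion gD.1 DT tJ (pJ i) JJ sX sY cx).
  have [_ tT' _ _] := hnab'.
  exact: (coneJ_torsion_type hS T'E i (X x) (Y x) tT' cx).
by move=> c x u cx; exact: coneJ_quaternion.
Qed.
End HKT.

Theorem corollary4p3p1 (R : realType) (n : nat) (hn : (1 <= n)%N)
    (M : manifold R (4 * n + 3)%N) (S : contact3 M)
    (beta : M -> R) (b : R) (nab T : tensor12 M)
    (hS : almost_3contact_metric S)
    (hcan : canonical_a3cm S beta)
    (hnab : canonical_connection S beta nab T)
    (hbeta : forall p : M, beta p = b) (hb : b < 0) :
  let a := - b / 2 in
  (forall nab' T' : tensor12 M,
     skew_torsion_connection (ac_g S) nab' T' ->
     (forall c x u v w, cimg M c x ->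
        ac_g S c x (T' c x u v) w =
        ac_g S c x (T c x u v) w
        + b * \sum_(i < 3) wedge12 (ac_eta S i) (Phi S i) c x u v w) ->
     (exists D : tensor12 (cone M), appendant a (ac_g S) T' D) /\
     (forall D : tensor12 (cone M), appendant a (ac_g S) T' D ->
        hermitian_connection (cone_metric a (ac_g S)) (coneJ a S) D)) /\
  (forall alpha delta : R, three_alpha_delta_sasaki S alpha delta ->
     HKT (cone_metric a (ac_g S)) (coneJ a S)).
Proof.
have b0 : b != 0 by rewrite lt_eqF.
have a0 : - b / 2 != 0 by rewrite mulf_neq0// ?oppr_eq0// invr_eq0 pnatr_eq0.
split=> [nab' T' hnab' hT'|alpha delta hsas]; last exact: (cone_HKT hS hnab hbeta b0 hsas).
split; first exact: (appendant_exists a0 (ac_metric hS) hnab').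
by move=> D; exact: (deformed_appendant_hermitian hS hnab hbeta b0 hnab' hT').
Qed.
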